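(* Let $\mathfrak I$ be a testing ideal and $\Delta_{\mathfrak I}$ the associated ideal-generated assignment. Let $X$ and $Y$ be Banach spaces such that: (a) $X^{**}$ and $Y^{**}$ have the approximation property; (b) $\widehat G(B_{X^*\widehat\otimes_\pi Y^*})$ is weak$^*$-sequentially dense in $B_{(X\widehat\otimes_\varepsilon Y)^*}$; (c) $B_{X^*}$ and $B_{Y^*}$ are weak$^*$-sequentially compact; (d) either $\Delta_{\mathfrak I}(X)$ or $\Delta_{\mathfrak I}(Y)$ has the approximation property. Suppose further that $X$ is complemented in $\Delta_{\mathfrak I}(X)$ and that $Y$ is complemented in $\Delta_{\mathfrak I}(Y)$. Then \[ \mathcal S_{\mathfrak I}(X\widehat\otimes_\varepsilon Y)\sim\bigl(X\widehat\otimes_\varepsilon\mathcal S_{\mathfrak I}(Y)\bigr)\oplus\bigl(\mathcal S_{\mathfrak I}(X)\widehat\otimes_\varepsilon Y\bigr)\oplus\bigl(\mathcal S_{\mathfrak I}(X)\widehat\otimes_\varepsilon\mathcal S_{\mathfrak I}(Y)\bigr). \]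
   Context: Banach spaces are real; $X\subset X^{**}$ canonically; $B_Z$ is the closed unit ball of $Z$; $\sim$ denotes linear isomorphism; $\widehat\otimes_\varepsilon$ and $\widehat\otimes_\pi$ are the injective and projective tensor products. A testing ideal is a rule $\mathfrak I$ assigning to each Banach space $X$ an ideal $\mathfrak I(X^* )$ of subsets of $X^*$ (a family containing $\emptyset$, closed under subsets and finite unions) such that: (1) every countable subset of $X^*$ is in $\mathfrak I(X^* )$; (2) if $T:X\to Y$ is bounded linear and $A\in\mathfrak I(Y^* )$, then $T^*(A)\in\mathfrak I(X^* )$; (3) if $X,Y$ are Banach spaces, $A\in\mathfrak I(\mathcal L(X,Y^* ))$ (where $\mathcal L(X,Y^* )\cong(X\widehat\otimes_\pi Y)^*$) and $y^{**}\in\Delta_{\mathfrak I}(Y)$, then $\{y^{**}\circ T:T\in A\}\in\mathfrak I(X^* )$. Here $\Delta_{\mathfrak I}(X)$ is the norm closure in $X^{**}$ of \[\Delta^0_{\mathfrak I}(X)=\{x^{**}\in X^{**}:\forall A\in\mathfrak I(X^* )\ \exists x\in X\ \text{with}\ x^{**}|_A=x|_A\},\] called the ideal-generated assignment, and $\mathcal S_{\mathfrak I}(X)=\Delta_{\mathfrak I}(X)/X$. $\widehat G:X^*\widehat\otimes_\pi Y^*\to(X\widehat\otimes_\varepsilon Y)^*$ is the canonical norm-one operator determined by $\widehat G(x^*\otimes y^* )(x\otimes y)=x^*(x)y^*(y)$. A set $S$ is weak$^*$-sequentially dense in $B$ if every element of $B$ is the weak$^*$-limit of a sequence from $S$. $B_{X^*}$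 is weak$^*$-sequentially compact if every sequence in it has a weak$^*$-convergent subsequence. *)

(* Defs.v *)
From HB Require Import structures.
From mathcomp Require Import all_boot all_order all_algebra.
From mathcomp Require Import all_classical all_reals all_analysis ring lra.

Set Implicit Arguments.
Unset Strict Implicit.
Unset Printing Implicit Defensive.

Import Order.TTheory GRing.Theory Num.Theory numFieldNormedType.Exports.

Local Open Scope classical_set_scope.
Local Open Scope ring_scope.
Local Open Scope quotient_scope.

Section sequential_completeness.
Context {R : realType}.

Definition seq_cauchy (E : lmodType R) (p : E -> R) (u : nat -> E) :=
  forall e : R, 0 < e ->
    exists N, forall m n, (N <= m)%N -> (N <= n)%N -> p (u m - u n) < e.

Definition seq_limit (E : lmodType R) (p : E -> R) (u : nat -> E) (l : E) :=
  forall e : R, 0 < e -> exists N, forall n, (N <= n)%N -> p (u n - l) < e.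

Lemma natSinv_lt (e : R) : 0 < e ->
  exists N, forall n, (N <= n)%N -> n.+1%:R^-1 < e.
Proof.
move=> e0; have [N _ HN] := near_infty_natSinv_lt (PosNum e0).
by exists N => n Nn; exact: HN.
Qed.

Lemma seq_complete_cvg (V : normedModType R) :
  (forall u : nat -> V, seq_cauchy Num.norm u ->
     exists l, seq_limit Num.norm u l) ->
  forall F : set_system V, ProperFilter F -> cauchy F -> cvg F.
Proof.
move=> Vc F PF /cauchyP Fc.
have inv0 n : 0 < n.+1%:R^-1 :> R by rewrite invr_gt0 ltr0n.
have /choice[x Fx] : forall n : nat, exists x : V, F (ball x n.+1%:R^-1).
  by move=> n; exact: Fc.
have dx m n : `|x m - x n| < m.+1%:R^-1 + n.+1%:R^-1.
  have [z [/= zm zn]] :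
    exists z, (ball (x m) m.+1%:R^-1 `&` ball (x n) n.+1%:R^-1) z.
    by apply: (@filter_ex _ F); apply: filterI; exact: Fx.
  move: zm zn; rewrite -!ball_normE /= => zm zn.
  rewrite -(subrKA z) (le_lt_trans (ler_normD _ _))// ltrD//.
  by rewrite distrC.
have [l xl] : exists l, seq_limit Num.norm x l.
  apply: Vc => e e0; have e20 : 0 < e / 2 by rewrite divr_gt0.
  have [N HN] := natSinv_lt e20.
  exists N => m n Nm Nn; rewrite (lt_trans (dx m n))// (splitr e) ltrD//;
  exact: HN.
apply/cvg_ex; exists l => A /nbhs_ballP[e /= e0 lA].
have e20 : 0 < e / 2 by rewrite divr_gt0.
have [N HN] := natSinv_lt e20; have [M HM] := xl _ e20.
apply: filterS (Fx (maxn N M)) => z.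
rewrite -ball_normE /= => xz; apply: lA; rewrite -ball_normE /=.
rewrite -(subrKA (x (maxn N M))) (splitr e) (le_lt_trans (ler_normD _ _))// ltrD//.
  by rewrite distrC HM ?leq_maxr.
by rewrite (lt_trans xz)// HN ?leq_maxl.
Qed.

Lemma seq_limitP (V : normedModType R) (u : nat -> V) (l : V) :
  seq_limit Num.norm u l <-> u @ \oo --> l.
Proof.
split=> [ul|/cvgrPdist_lt ul].
  apply/cvgrPdist_lt => e /ul[N HN].
  by exists N => // n Nn /=; rewrite distrC; exact: HN.
by move=> e /ul[N _ HN]; exists N => n Nn; rewrite distrC; exact: HN.
Qed.

Lemma complete_seq (V : completeNormedModType R) (u : nat -> V) :
  seq_cauchy Num.norm u -> exists l, seq_limit Num.norm u l.
Proof.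
move=> uc; have : cvg (u @ \oo).
  apply: cauchy_cvg; apply/cauchyP => e e0.
  have [N HN] := uc _ e0; exists (u N); exists N => // n /= Nn.
  by rewrite -ball_normE /=; exact: HN.
move=> /cvg_ex[l ul]; exists l => e e0.
have /cvgrPdist_lt/(_ _ e0)[N _ HN] := ul.
by exists N => n Nn; rewrite distrC; exact: HN.
Qed.

End sequential_completeness.

Section direct_sum.
Context {R : realType} (V W : completeNormedModType R).

HB.instance Definition _ := Pointed.on (V * W)%type.

Lemma prod_complete (F : set_system (V * W)) :
  ProperFilter F -> cauchy F -> cvg F.
Proof.
apply: seq_complete_cvg => u uc.
have [l ul] : exists l, seq_limit Num.norm (fst \o u) l.
  apply: complete_seq => e /uc[N HN]; exists N => m n Nm Nn.
  by have := HN m n Nm Nn; rewrite prod_normE gt_max => /andP[].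
have [k uk] : exists l, seq_limit Num.norm (snd \o u) l.
  apply: complete_seq => e /uc[N HN]; exists N => m n Nm Nn.
  by have := HN m n Nm Nn; rewrite prod_normE gt_max => /andP[].
exists (l, k) => e e0; have [N HN] := ul _ e0; have [M HM] := uk _ e0.
exists (maxn N M) => n; rewrite geq_max => /andP[Nn Mn].
by rewrite prod_normE gt_max HN// HM.
Qed.

HB.instance Definition _ := Uniform_isComplete.Build (V * W)%type prod_complete.

End direct_sum.

Record subspace (R : realType) (V : lmodType R) := Subspace {
  ss_set : set V;
  ss_submod : submod_closed [pred x | `[< ss_set x >]] }.

Section closed_subspace.
Context {R : realType} (V : completeNormedModType R).

Record csubspace := Csubspace {
  cs_subspace :> subspace V;
  cs_closed : closed (ss_set cs_subspace) }.

Variable S : csubspace.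

Definition cs_pred : {pred V} := [pred x | `[< ss_set S x >]].

HB.instance Definition _ := GRing.isSubmodClosed.Build R V cs_pred (ss_submod S).

Record cs_type := CsType { cs_val :> V; _ : cs_val \in cs_pred }.

HB.instance Definition _ := [isSub for cs_val].
HB.instance Definition _ := [Choice of cs_type by <:].
HB.instance Definition _ := [SubChoice_isSubLmodule of cs_type by <:].

Lemma cs_normD (x y : cs_type) : `|val (x + y)| <= `|val x| + `|val y|.
Proof. exact: ler_normD. Qed.

Lemma cs_normZ a (x : cs_type) : `|val (a *: x)| = `|a| * `|val x|.
Proof. exact: normrZ. Qed.

Lemma cs_norm_eq0 (x : cs_type) : `|val x| = 0 -> x = 0.
Proof. by move=> /normr0_eq0 x0; apply: val_inj. Qed.

HB.instance Definition _ :=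
  Lmodule_isNormed.Build R cs_type cs_normD cs_normZ cs_norm_eq0.

Lemma cs_normE (x : cs_type) : `|x| = `|val x|. Proof. by []. Qed.

Lemma cs_valP (x : cs_type) : ss_set S (val x).
Proof. by have /asboolP := valP x. Qed.

Lemma cs_complete (F : set_system cs_type) : ProperFilter F -> cauchy F -> cvg F.
Proof.
apply: seq_complete_cvg => u uc.
have [l ul] : exists l, seq_limit Num.norm (val \o u) l.
  by apply: complete_seq => e /uc[N HN]; exists N => m n Nm Nn; exact: HN.
have Sl : ss_set S l.
  apply: (@cs_closed S) => B /nbhs_ballP[e /= e0 lB].
  have [N HN] := ul _ e0; exists (val (u N)); split; first exact: cs_valP.
  by apply: lB; rewrite -ball_normE /= distrC; exact: HN.
have Sl' : l \in cs_pred by exact/asboolP.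
by exists (CsType Sl').
Qed.

HB.instance Definition _ := Uniform_isComplete.Build cs_type cs_complete.

End closed_subspace.

Section complete_seminorm.
Context {R : realType}.

Record seminorm (E : lmodType R) := Seminorm {
  sn :> E -> R;
  sn_triangle : forall x y, sn (x + y) <= sn x + sn y;
  sn_homogeneous : forall a x, sn (a *: x) = `|a| * sn x }.

Record cseminorm (E : lmodType R) := Cseminorm {
  csn :> seminorm E;
  csn_complete : forall u, seq_cauchy csn u -> exists l, seq_limit csn u l }.

Section seminorm_lemmas.
Variables (E : lmodType R) (p : seminorm E).

Lemma sn0 : p 0 = 0.
Proof. by rewrite -(scale0r (0 : E)) sn_homogeneous normr0 mul0r. Qed.

Lemma snN x : p (- x) = p x.
Proof. by rewrite -scaleN1r sn_homogeneous normrN1 mul1r. Qed.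

Lemma sn_ge0 x : 0 <= p x.
Proof.
have := sn_triangle p x (- x); rewrite subrr sn0 snN -mulr2n.
by rewrite pmulrn_lge0.
Qed.

Lemma snBC x y : p (x - y) = p (y - x).
Proof. by rewrite -snN opprB. Qed.

Lemma sn_dist x y : `|p x - p y| <= p (x - y).
Proof.
rewrite ler_norml lerBlDr lerNl opprB lerBlDr; apply/andP; split.
  by rewrite snBC -{1}(subrK x y) sn_triangle.
by rewrite -{1}(subrK y x) sn_triangle.
Qed.

Lemma sn_distl x y z : p (x - z) <= p (x - y) + p (y - z).
Proof. by rewrite -(subrKA y) sn_triangle. Qed.

End seminorm_lemmas.

Section hausdorff_quotient.
Variables (E : lmodType R) (p : cseminorm E).

Definition sn_rel : rel E := fun x y => p (x - y) == 0.

Lemma sn_rel_refl : reflexive sn_rel.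
Proof. by move=> x; rewrite /sn_rel subrr sn0. Qed.

Lemma sn_rel_sym : symmetric sn_rel.
Proof. by move=> x y; rewrite /sn_rel snBC. Qed.

Lemma sn_rel_trans : transitive sn_rel.
Proof.
move=> y x z /eqP xy /eqP yz; rewrite /sn_rel eq_le sn_ge0 andbT.
by rewrite (le_trans (sn_distl p x y z))// xy yz addr0.
Qed.

Canonical sn_equiv := EquivRel sn_rel sn_rel_refl sn_rel_sym sn_rel_trans.

(* The quotient of [E] by the null vectors of a complete seminorm [p]; the class of
   [x] is [hpi x] and has norm [p x] ([norm_hpi]), so this is a Banach space. *)
Definition hausdorff := {eq_quot sn_rel}%qT.

HB.instance Definition _ := Choice.on hausdorff.
HB.instance Definition _ := EqQuotient.on hausdorff.

Definition hpi (x : E) : hausdorff := \pi_(hausdorff) x.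

Lemma hpiP x y : hpi x = hpi y <-> p (x - y) = 0.
Proof. by split=> [/eqmodP/eqP|/eqP xy]; last exact/eqmodP. Qed.

Lemma hpiK q : hpi (repr q) = q. Proof. exact: reprK. Qed.

Lemma repr_hpi x : p (repr (hpi x) - x) = 0.
Proof. by apply/hpiP; rewrite hpiK. Qed.

Lemma hausdorffW (P : hausdorff -> Prop) : (forall x, P (hpi x)) -> forall q, P q.
Proof. by move=> H q; rewrite -(hpiK q). Qed.

Definition hadd (q r : hausdorff) := hpi (repr q + repr r).
Definition hopp (q : hausdorff) := hpi (- repr q).
Definition hscale (a : R) (q : hausdorff) := hpi (a *: repr q).
Definition hnorm (q : hausdorff) : R := p (repr q).

Lemma sn_eq0D x y : p x = 0 -> p y = 0 -> p (x + y) = 0.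
Proof.
by move=> x0 y0; apply/eqP; rewrite eq_le sn_ge0 (le_trans (sn_triangle _ _ _))// x0 y0 addr0.
Qed.

Lemma haddE x y : hadd (hpi x) (hpi y) = hpi (x + y).
Proof. by apply/hpiP; rewrite opprD addrACA sn_eq0D// repr_hpi. Qed.

Lemma hoppE x : hopp (hpi x) = hpi (- x).
Proof. by apply/hpiP; rewrite -opprD snN repr_hpi. Qed.

Lemma hscaleE a x : hscale a (hpi x) = hpi (a *: x).
Proof. by apply/hpiP; rewrite -scalerBr sn_homogeneous repr_hpi mulr0. Qed.

Lemma hnormE x : hnorm (hpi x) = p x.
Proof.
apply/eqP; rewrite -subr_eq0 -normr_eq0 eq_le normr_ge0 andbT.
by rewrite -(repr_hpi x) sn_dist.
Qed.

Lemma haddA : associative hadd.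
Proof. by do 3!elim/hausdorffW=> ?; rewrite !haddE addrA. Qed.
Lemma haddC : commutative hadd.
Proof. by do 2!elim/hausdorffW=> ?; rewrite !haddE addrC. Qed.
Lemma hadd0 : left_id (hpi 0) hadd.
Proof. by elim/hausdorffW=> ?; rewrite haddE add0r. Qed.
Lemma haddN : left_inverse (hpi 0) hopp hadd.
Proof. by elim/hausdorffW=> ?; rewrite hoppE haddE addNr. Qed.

HB.instance Definition _ :=
  GRing.isZmodule.Build hausdorff haddA haddC hadd0 haddN.

Lemma hscaleA a b q : hscale a (hscale b q) = hscale (a * b) q.
Proof. by elim/hausdorffW: q => ?; rewrite !hscaleE scalerA. Qed.
Lemma hscale1 : left_id 1 hscale.
Proof. by elim/hausdorffW=> ?; rewrite hscaleE scale1r. Qed.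
Lemma hscaleDr : right_distributive hscale +%R.
Proof.
move=> a; do 2!elim/hausdorffW=> ?.
by rewrite /GRing.add /= haddE !hscaleE haddE scalerDr.
Qed.
Lemma hscaleDl q : {morph hscale^~ q : a b / a + b}.
Proof.
by elim/hausdorffW: q => x a b; rewrite !hscaleE /GRing.add /= haddE scalerDl.
Qed.

HB.instance Definition _ := GRing.Zmodule_isLmodule.Build R hausdorff
  hscaleA hscale1 hscaleDr hscaleDl.

Lemma hpi_linear : linear hpi.
Proof. by move=> a x y; rewrite -haddE -hscaleE. Qed.

HB.instance Definition _ := GRing.isLinear.Build R E hausdorff _ hpi hpi_linear.

Lemma hnormD q r : hnorm (q + r) <= hnorm q + hnorm r.
Proof.
by elim/hausdorffW: q => x; elim/hausdorffW: r => y; rewrite -linearD !hnormE sn_triangle.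
Qed.
Lemma hnormZ a q : hnorm (a *: q) = `|a| * hnorm q.
Proof.
by elim/hausdorffW: q => x; rewrite -linearZ/= !hnormE sn_homogeneous.
Qed.
Lemma hnorm_eq0 q : hnorm q = 0 -> q = 0.
Proof.
elim/hausdorffW: q => x; rewrite hnormE => x0.
by rewrite -(linear0 hpi); apply/hpiP; rewrite subr0.
Qed.

HB.instance Definition _ :=
  Lmodule_isNormed.Build R hausdorff hnormD hnormZ hnorm_eq0.

Lemma norm_hpi x : `|hpi x| = p x. Proof. exact: hnormE. Qed.

Lemma hausdorff_complete (F : set_system hausdorff) :
  ProperFilter F -> cauchy F -> cvg F.
Proof.
apply: seq_complete_cvg => u uc.
have [l ul] : exists l, seq_limit p (repr \o u) l.
  apply: csn_complete => e /uc[N HN]; exists N => m n Nm Nn.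
  by rewrite /= -norm_hpi linearB/= !hpiK HN.
exists (hpi l) => e /ul[N HN]; exists N => n /HN /=.
by rewrite -norm_hpi linearB/= hpiK.
Qed.

HB.instance Definition _ := Uniform_isComplete.Build hausdorff hausdorff_complete.

End hausdorff_quotient.
End complete_seminorm.

Section bounded_operators.
Context {R : realType} (X Y : normedModType R).

Definition bop_pred : {pred X -> Y} :=
  [pred f | `[< linear f /\ exists C : R, forall x, `|f x| <= C * `|x| >]].

Lemma bop_submod : submod_closed bop_pred.
Proof.
split.
  apply/asboolP; split; first by move=> a x y; rewrite /= scaler0 addr0.
  by exists 0 => x; rewrite normr0 mul0r.
move=> a f g /asboolP[fl [C fC]] /asboolP[gl [D gD]]; apply/asboolP; split.
  move=> b x y; rewrite !fctE /= fl gl !scalerDr addrACA.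
  by rewrite !scalerA mulrC.
exists (`|a| * C + D) => x.
rewrite !fctE (le_trans (ler_normD _ _))// mulrDl lerD// normrZ -mulrA.
by rewrite ler_wpM2l.
Qed.

HB.instance Definition _ := GRing.isSubmodClosed.Build R (X -> Y) bop_pred bop_submod.

Record bop := Bop { bop_fun :> X -> Y; _ : bop_fun \in bop_pred }.

HB.instance Definition _ := [isSub for bop_fun].
HB.instance Definition _ := [Choice of bop by <:].
HB.instance Definition _ := [SubChoice_isSubLmodule of bop by <:].

Lemma bop_linear (f : bop) : linear f.
Proof. by have /asboolP[] := valP f. Qed.

HB.instance Definition _ (f : bop) :=
  GRing.isLinear.Build R X Y _ f (bop_linear f).

Lemma bopP (f g : bop) : f =1 g <-> f = g.
Proof. by split=> [fg|->//]; apply/val_inj/funext. Qed.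

Lemma bop_bounded (f : bop) : exists C : R, 0 <= C /\ forall x, `|f x| <= C * `|x|.
Proof.
have /asboolP[_ [C fC]] := valP f; exists `|C|; split=> // x.
by rewrite (le_trans (fC x))// ler_wpM2r// ler_norm.
Qed.

Definition opnorm (f : bop) : R := sup [set `|f x| | x in [set x | `|x| <= 1]].

Lemma opnorm_has_sup (f : bop) : has_sup [set `|f x| | x in [set x | `|x| <= 1]].
Proof.
split; first by exists `|f 0|; exists 0 => //=; rewrite normr0.
have [C [C0 fC]] := bop_bounded f; exists C => _ [x /= x1 <-].
by rewrite (le_trans (fC x))// ler_piMr.
Qed.

Lemma opnorm_ge0 f : 0 <= opnorm f.
Proof.
apply: (@le_trans _ _ `|f 0|) => //.
by apply: (sup_upper_bound (opnorm_has_sup f)); exists 0 => //=; rewrite normr0.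
Qed.

Lemma opnormP (f : bop) x : `|f x| <= opnorm f * `|x|.
Proof.
have [->|x0] := eqVneq x 0; first by rewrite linear0 !normr0 mulr0.
have nx0 : 0 < `|x| by rewrite normr_gt0.
rewrite -ler_pdivrMr//.
have <- : `|f (`|x|^-1 *: x)| = `|f x| / `|x|.
  by rewrite linearZ/= normrZ normfV normr_id mulrC.
apply: (sup_upper_bound (opnorm_has_sup f)); exists (`|x|^-1 *: x) => //=.
by rewrite normrZ normfV normr_id mulVf// gt_eqF.
Qed.

Lemma opnorm_le (f : bop) (C : R) : 0 <= C -> (forall x, `|f x| <= C * `|x|) ->
  opnorm f <= C.
Proof.
move=> C0 fC; apply: ge_sup; first by case: (opnorm_has_sup f).
by move=> _ [x /= x1 <-]; rewrite (le_trans (fC x))// ler_piMr.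
Qed.

Lemma opnormD f g : opnorm (f + g) <= opnorm f + opnorm g.
Proof.
apply: opnorm_le; first by rewrite addr_ge0// opnorm_ge0.
by move=> x; rewrite mulrDl (le_trans (ler_normD _ _))// lerD// opnormP.
Qed.

Lemma opnormZ_le a f : opnorm (a *: f) <= `|a| * opnorm f.
Proof.
apply: opnorm_le; first by rewrite mulr_ge0// opnorm_ge0.
by move=> x; rewrite normrZ -mulrA ler_wpM2l// opnormP.
Qed.

Lemma opnormZ a f : opnorm (a *: f) = `|a| * opnorm f.
Proof.
apply/eqP; rewrite eq_le opnormZ_le /=.
have [->|a0] := eqVneq a 0; first by rewrite normr0 mul0r opnorm_ge0.
have := opnormZ_le a^-1 (a *: f).
by rewrite scalerA mulVf// scale1r normfV ler_pdivlMl// normr_gt0.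
Qed.

Lemma opnorm_eq0 f : opnorm f = 0 -> f = 0.
Proof.
move=> f0; apply/bopP => x; apply/eqP; rewrite -normr_le0.
by rewrite (le_trans (opnormP f x))// f0 mul0r.
Qed.

HB.instance Definition _ := Lmodule_isNormed.Build R bop opnormD opnormZ opnorm_eq0.

Lemma bop_normP (f : bop) x : `|f x| <= `|f| * `|x|. Proof. exact: opnormP. Qed.

Lemma bop_norm_le (f : bop) (C : R) : 0 <= C -> (forall x, `|f x| <= C * `|x|) ->
  `|f| <= C.
Proof. exact: opnorm_le. Qed.

Section mkbop.
Variables (f : X -> Y) (fl : linear f) (C : R) (fC : forall x, `|f x| <= C * `|x|).

Lemma mkbop_subproof : f \in bop_pred.
Proof. by apply/asboolP; split=> //; exists C. Qed.

Definition mkbop := Bop mkbop_subproof.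
End mkbop.

End bounded_operators.

Section bounded_operators_complete.
Context {R : realType} (X : normedModType R) (Y : completeNormedModType R).

Lemma bop_complete (F : set_system (bop X Y)) : ProperFilter F -> cauchy F -> cvg F.
Proof.
apply: seq_complete_cvg => u uc.
have /choice[g ug] : forall x, exists l : Y, (fun n => u n x) @ \oo --> l.
  move=> x; suff [l ul] : exists l, seq_limit Num.norm (fun n => u n x) l.
    by exists l; exact/seq_limitP.
  apply: complete_seq => e e0.
  have x0 : 0 < `|x| + 1 by rewrite ltr_wpDl.
  have [N HN] := uc _ (divr_gt0 e0 x0).
  exists N => m n Nm Nn; have := HN m n Nm Nn; rewrite ltr_pdivlMr//.
  apply: le_lt_trans; apply: (le_trans (bop_normP (u m - u n) x)).
  by rewrite ler_wpM2l// lerDl.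
have gl : linear g.
  move=> a x y; apply: (cvg_unique _ (ug _)); first exact: norm_hausdorff.
  rewrite (_ : (fun n => _) = (fun n => a *: u n x + u n y)); last first.
    by apply/funext => n; rewrite linearP.
  by apply: cvgD; [apply: cvgZl_tmp; exact: ug|exact: ug].
have ug_le e : 0 < e -> exists N, forall n x, (N <= n)%N ->
    `|u n x - g x| <= e * `|x|.
  move=> /uc[N HN]; exists N => n x Nn.
  have : (fun m => `|u n x - u m x|) @ \oo --> `|u n x - g x|.
    by apply: cvg_norm; apply: cvgB; [exact: cvg_cst|exact: ug].
  move/(@cvgr_to_le _ _ _ _ _ _ (e * `|x|)); apply.
  exists N => // m Nm /=; apply: (le_trans (bop_normP (u n - u m) x)).
  by rewrite ler_wpM2r// ltW// HN.
have [N1 HN1] := ug_le _ ltr01.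
have gb : forall x, `|g x| <= (`|u N1| + 1) * `|x|.
  move=> x; rewrite mulrDl -[g x](subrK (u N1 x)) addrC (le_trans (ler_normD _ _))//.
  by rewrite lerD ?bop_normP// distrC HN1.
exists (mkbop gl gb) => e e0.
have e20 : 0 < e / 2 by rewrite divr_gt0.
have [N HN] := ug_le _ e20; exists N => n Nn.
apply: (@le_lt_trans _ _ (e / 2)); last by rewrite ltr_pdivrMr// ltr_pMr// ltr1n.
by apply: bop_norm_le => [|x]; [exact: ltW|exact: HN].
Qed.

HB.instance Definition _ := Uniform_isComplete.Build (bop X Y) bop_complete.

End bounded_operators_complete.

Section duals.
Context {R : realType}.
Implicit Types X Y Z : completeNormedModType R.

Definition dual X : completeNormedModType R := bop X R^o.

Definition bidual X : completeNormedModType R := dual (dual X).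

Lemma bcomp_linear X Y Z (g : bop Y Z) (f : bop X Y) : linear (g \o f).
Proof. by move=> a x y; rewrite /= !linearP. Qed.

Lemma bcomp_bounded X Y Z (g : bop Y Z) (f : bop X Y) x :
  `|(g \o f) x| <= (`|g| * `|f|) * `|x|.
Proof.
by rewrite /= (le_trans (bop_normP g _))// -mulrA ler_wpM2l// bop_normP.
Qed.

Definition bcomp X Y Z (g : bop Y Z) (f : bop X Y) : bop X Z :=
  mkbop (bcomp_linear g f) (bcomp_bounded g f).

Lemma evalb_linear X (x : X) : linear (fun f : dual X => f x : R^o).
Proof. by []. Qed.

Lemma evalb_bounded X (x : X) (f : dual X) : `|f x| <= `|x| * `|f|.
Proof. by rewrite mulrC; exact: bop_normP. Qed.

Definition evalb X (x : X) : bidual X := mkbop (evalb_linear x) (evalb_bounded x).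

Lemma evalb_is_linear X : linear (@evalb X).
Proof. by move=> a x y; apply/bopP => f; rewrite /= linearP. Qed.

Lemma evalb_norm_le X (x : X) : `|evalb x| <= 1 * `|x|.
Proof. by rewrite mul1r; apply: bop_norm_le => // f; exact: (evalb_bounded x f). Qed.

Definition canonical_embedding X : bop X (bidual X) :=
  mkbop (@evalb_is_linear X) (@evalb_norm_le X).

End duals.

Section quotient.
Context {R : realType} (V : completeNormedModType R) (W : subspace V).

Lemma subspaceP a x y : ss_set W x -> ss_set W y -> ss_set W (a *: x + y).
Proof.
by move=> /asboolP Wx /asboolP Wy; have [_ /(_ a x y Wx Wy)/asboolP] := ss_submod W.
Qed.

Lemma subspace0 : ss_set W 0.
Proof. by have [/asboolP] := ss_submod W. Qed.

Definition dist (v : V) : R := inf [set `|v - w| | w in ss_set W].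

Lemma dist_has_inf v : has_inf [set `|v - w| | w in ss_set W].
Proof.
split; first by exists `|v - 0|, 0 => //; exact: subspace0.
by exists 0 => _ [w _ <-].
Qed.

Lemma dist_le v w : ss_set W w -> dist v <= `|v - w|.
Proof.
by move=> Ww; apply: inf_lbound; [case: (dist_has_inf v)|exists w].
Qed.

Lemma dist_lt v e : dist v < e -> exists2 w, ss_set W w & `|v - w| < e.
Proof.
by move=> /(inf_lt (dist_has_inf v).1)[_ [w Ww <-] we]; exists w.
Qed.

Lemma dist_adherent v e : 0 < e -> exists2 w, ss_set W w & `|v - w| < dist v + e.
Proof. by move=> e0; apply: dist_lt; rewrite ltrDl. Qed.

Lemma dist_ge0 v : 0 <= dist v.
Proof.
apply: lb_le_inf; first by case: (dist_has_inf v).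
by move=> _ [w _ <-].
Qed.

Lemma distD x y : dist (x + y) <= dist x + dist y.
Proof.
apply/ler_addgt0Pl => e e0; have e20 : 0 < e / 2 by rewrite divr_gt0.
have [v Wv xv] := dist_adherent x e20; have [w Ww yw] := dist_adherent y e20.
apply: (@le_trans _ _ `|(x + y) - (v + w)|).
  by apply: dist_le; rewrite -[v]scale1r; exact: subspaceP.
rewrite opprD addrACA (le_trans (ler_normD _ _))//.
by move: xv yw; lra.
Qed.

Lemma distZ_le a x : dist (a *: x) <= `|a| * dist x.
Proof.
have [->|a0] := eqVneq a 0.
  rewrite scale0r normr0 mul0r; apply: (le_trans (dist_le 0 subspace0)).
  by rewrite subr0 normr0.
rewrite -ler_pdivrMl ?normr_gt0//; apply: lb_le_inf; first by case: (dist_has_inf x).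
move=> _ [w Ww <-]; rewrite ler_pdivrMl ?normr_gt0// -normrZ scalerBr.
by apply: dist_le; rewrite -[a *: w]addr0; exact: subspaceP subspace0.
Qed.

Lemma distZ a x : dist (a *: x) = `|a| * dist x.
Proof.
apply/eqP; rewrite eq_le distZ_le /=.
have [->|a0] := eqVneq a 0; first by rewrite normr0 mul0r dist_ge0.
have := distZ_le a^-1 (a *: x).
by rewrite scalerA mulVf// scale1r normfV ler_pdivlMl// normr_gt0.
Qed.

Definition dist_seminorm := Seminorm distD distZ.

Lemma dist_eq0 w : ss_set W w -> dist w = 0.
Proof.
move=> Ww; apply/eqP; rewrite eq_le dist_ge0 andbT.
by have := dist_le w Ww; rewrite subrr normr0.
Qed.

Lemma dist_complete (u : nat -> V) : seq_cauchy dist_seminorm u ->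
  exists l, seq_limit dist_seminorm u l.
Proof.
move=> uc; pose h k : R := 2^-1 ^+ k.
have h0 k : 0 < h k by rewrite exprn_gt0// invr_gt0.
have hS k : h k = h k.+1 + h k.+1.
  by rewrite /h exprS; lra.
have /choice[N HN] := fun k => uc _ (h0 k).
pose M k := (\sum_(i < k.+1) N i)%N.
have NM k : (N k <= M k)%N by rewrite /M big_ord_recr leq_addl.
have MS k : (M k <= M k.+1)%N by rewrite /M [leqRHS]big_ord_recr leq_addr.
have /choice[s sP] : forall kv : nat * V, exists v', ss_set W (v' - u (M kv.1.+1)) /\
    (dist (u (M kv.1.+1) - kv.2) < h kv.1 -> `|v' - kv.2| < h kv.1).
  move=> [k v] /=; have [/dist_lt[w Ww vw]|] := pselect (dist (u (M k.+1) - v) < h k).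
    exists (u (M k.+1) - w); split.
      by rewrite addrAC subrr add0r -scaleN1r -[_ *: _]addr0; exact: subspaceP subspace0.
    by move=> _; rewrite addrAC.
  by move=> nlt; exists (u (M k.+1)); split=> //; rewrite subrr; exact: subspace0.
pose fix v k : V := if k is k'.+1 then s (k', v k') else u (M 0%N).
have vu k : ss_set W (v k - u (M k)).
  by case: k => [|k] /=; [rewrite subrr; exact: subspace0|case: (sP (k, v k))].
have d0 k : dist (u (M k) - v k) = 0.
  by rewrite -[LHS]/(dist_seminorm _) snBC; exact: dist_eq0.
have vv k : `|v k.+1 - v k| < h k.
  have [_] := sP (k, v k); apply => /=.
  rewrite -(subrKA (u (M k))) (le_lt_trans (distD _ _))//.
  rewrite d0 addr0.
  by apply: HN; [exact: leq_trans (NM k) (MS k)|exact: NM].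
have vtail k j : `|v (k + j)%N - v k| <= h k + h k - (h (k + j)%N + h (k + j)%N).
  elim: j => [|j IH]; first by rewrite addn0 subrr normr0 subrr.
  rewrite addnS -(subrKA (v (k + j)%N)) (le_trans (ler_normD _ _))//.
  rewrite (le_trans (lerD (ltW (vv _)) IH))//.
  by have := hS (k + j)%N; lra.
have h_small e : 0 < e -> exists k, h k + h k < e.
  move=> e0; have e20 : 0 < e / 2 by rewrite divr_gt0.
  have : (fun n => h n) @ \oo --> (0 : R).
    by apply: cvg_expr; rewrite ger0_norm ?invr_ge0// invf_lt1// ltr1n.
  move=> /cvgrPdist_lt/(_ _ e20)[K _ /(_ K (leqnn K))].
  by rewrite sub0r normrN gtr0_norm// => hK; exists K; rewrite (splitr e) ltrD.
have [l vl] : exists l, seq_limit Num.norm v l.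
  apply: complete_seq => e e0; have e20 : 0 < e / 2 by rewrite divr_gt0.
  have [k hk] := h_small _ e20; exists k => m n km kn.
  have H i : (k <= i)%N -> `|v i - v k| < e / 2.
    move=> ki; rewrite -(subnKC ki); apply: le_lt_trans hk; apply: (le_trans (vtail _ _)).
    by rewrite gerBl// addr_ge0// ltW.
  rewrite -(subrKA (v k)) (splitr e) (le_lt_trans (ler_normD _ _))// ltrD ?H//.
  by rewrite distrC H.
exists l => e e0; have e20 : 0 < e / 2 by rewrite divr_gt0.
have [k hk] := h_small _ e20; have [K HK] := vl _ e20.
exists (N k) => n Nn /=.
pose i := maxn k K.
have dk : dist (u n - u (M i)) < e / 2.
  apply: (@lt_trans _ _ (h k)); last by apply: lt_trans hk; rewrite ltrDl.
  apply: HN => //; apply: (leq_trans (NM k)); rewrite /i.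
  by elim: (maxn k K) (leq_maxl k K) => [|j IH]; [rewrite leqn0 => /eqP->|
     rewrite leq_eqVlt => /predU1P[->//|/IH/leq_trans]; apply].
rewrite -(subrKA (u (M i))) (le_lt_trans (distD _ _))// (splitr e) ltr_leD// ltW//.
rewrite -(subrKA (v i)) (le_lt_trans (distD _ _))//.
by rewrite d0 add0r (le_lt_trans (dist_le _ subspace0))// subr0 HK// leq_maxr.
Qed.

(* The norm is that of V / W, the distance to W. For closed W the class of v vanishes
   exactly when v is in W ([qproj_eq0]), so this is the usual Banach quotient; for
   arbitrary W it is the quotient by the closure of W. *)
Definition quotient : completeNormedModType R :=
  hausdorff (Cseminorm dist_complete).

Definition qproj (v : V) : quotient := hpi _ v.

Lemma qproj_eq0 v : closed (ss_set W) -> qproj v = 0 <-> ss_set W v.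
Proof.
move=> Wc; rewrite -(linear0 (hpi (Cseminorm dist_complete))); split.
  move=> /hpiP; rewrite subr0 => /= v0; apply: Wc => B /nbhs_ballP[e /= e0 vB].
  have [w Ww vw] : exists2 w, ss_set W w & `|v - w| < e.
    by apply: dist_lt; rewrite v0.
  by exists w; split=> //; apply: vB; rewrite -ball_normE.
by move=> Wv; apply/hpiP; rewrite subr0 /= dist_eq0.
Qed.

End quotient.

Section completion.
Context {R : realType} (E : lmodType R) (p : seminorm E).

Definition cauchy_pred : {pred nat -> E} := [pred u | `[< seq_cauchy p u >]].

Lemma cauchy_submod : submod_closed cauchy_pred.
Proof.
split; first by apply/asboolP => e e0; exists 0%N => m n _ _; rewrite subrr sn0.
move=> a u v /asboolP uc /asboolP vc; apply/asboolP => e e0.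
have a0 : 0 < `|a| + 1 by rewrite ltr_wpDl.
have e20 : 0 < e / 2 by rewrite divr_gt0.
have [N HN] := uc _ (divr_gt0 e20 a0); have [M HM] := vc _ e20.
exists (maxn N M) => m n; rewrite !geq_max => /andP[Nm Mm] /andP[Nn Mn].
have -> : (a *: u + v) m - (a *: u + v) n = a *: (u m - u n) + (v m - v n).
  by rewrite !fctE opprD addrACA scalerBr.
rewrite (le_lt_trans (sn_triangle _ _ _))// (splitr e) ltrD ?HM//.
have := HN m n Nm Nn; rewrite ltr_pdivlMr//; apply: le_lt_trans.
by rewrite sn_homogeneous mulrC ler_wpM2l ?sn_ge0// lerDl.
Qed.

HB.instance Definition _ :=
  GRing.isSubmodClosed.Build R (nat -> E) cauchy_pred cauchy_submod.

(* The completion consists of the Cauchy sequences [u] of the seminormed space [E],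
   with seminorm [lim p (u n)], modulo null sequences. *)
Record cauchy_type := CauchyType { cauchy_val :> nat -> E; _ : cauchy_val \in cauchy_pred }.

HB.instance Definition _ := [isSub for cauchy_val].
HB.instance Definition _ := [Choice of cauchy_type by <:].
HB.instance Definition _ := [SubChoice_isSubLmodule of cauchy_type by <:].

Lemma cauchy_typeP (u : cauchy_type) : seq_cauchy p u.
Proof. by have /asboolP := valP u. Qed.

Definition mkcauchy u (uc : seq_cauchy p u) : cauchy_type :=
  CauchyType (introT (asboolP _) uc : u \in cauchy_pred).

Definition lim_norm (u : cauchy_type) : R := lim ((fun n => p (u n) : R^o) @ \oo).

Lemma lim_normP (u : cauchy_type) : (fun n => p (u n) : R^o) @ \oo --> lim_norm u.
Proof.
suff [l ul] : exists l : R^o, seq_limit Num.norm (fun n => p (u n) : R^o) l.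
  by apply/cvg_ex; exists l; exact/seq_limitP.
apply: complete_seq => e /(cauchy_typeP u)[N HN]; exists N => m n Nm Nn.
by apply: le_lt_trans (HN m n Nm Nn); exact: sn_dist.
Qed.

Lemma lim_norm_lt (u : cauchy_type) e : lim_norm u < e ->
  exists N, forall n, (N <= n)%N -> p (u n) < e.
Proof.
by move=> /(cvgr_lt _ (@lim_normP u))[N _ HN]; exists N => n /HN.
Qed.

Lemma lim_norm_le (u : cauchy_type) e N : (forall n, (N <= n)%N -> p (u n) <= e) ->
  lim_norm u <= e.
Proof.
by move=> H; apply: (cvgr_to_le (@lim_normP u)); exists N => // n /H.
Qed.

Lemma lim_normD u v : lim_norm (u + v) <= lim_norm u + lim_norm v.
Proof.
apply: (ler_cvg_to (@lim_normP (u + v)) (cvgD (@lim_normP u) (@lim_normP v))).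
by exists 0%N => // n _; exact: sn_triangle.
Qed.

Lemma lim_normZ a u : lim_norm (a *: u) = `|a| * lim_norm u.
Proof.
apply: (cvg_unique _ (@lim_normP (a *: u))); first exact: norm_hausdorff.
rewrite (_ : (fun n => _) = (fun n => `|a| *: (p (u n) : R^o))).
  exact: cvgZl_tmp (@lim_normP u).
by apply/funext => n; rewrite /= sn_homogeneous.
Qed.

Definition lim_seminorm := Seminorm lim_normD lim_normZ.

Lemma lim_seminorm_complete (U : nat -> cauchy_type) : seq_cauchy lim_seminorm U ->
  exists l, seq_limit lim_seminorm U l.
Proof.
move=> Uc.
have inv0 n : 0 < n.+1%:R^-1 :> R by rewrite invr_gt0 ltr0n.
have /choice[N HN] := fun k => cauchy_typeP (U k) (inv0 k).
pose v k := U k (N k).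
have vc : seq_cauchy p v.
  move=> e e0; have e30 : 0 < e / 3 by rewrite divr_gt0.
  have [K HK] := natSinv_lt e30; have [M HM] := Uc _ e30.
  exists (maxn K M) => k l; rewrite !geq_max => /andP[Kk Mk] /andP[Kl Ml].
  have [L HL] := lim_norm_lt (HM k l Mk Ml).
  pose m := maxn L (maxn (N k) (N l)).
  have Lm : (L <= m)%N by rewrite leq_maxl.
  have Nkm : (N k <= m)%N by rewrite (leq_trans _ (leq_maxr _ _))// leq_maxl.
  have Nlm : (N l <= m)%N by rewrite (leq_trans _ (leq_maxr _ _))// leq_maxr.
  have Hk : p (v k - U k m) < e / 3.
    exact: lt_trans (HN k _ _ (leqnn _) Nkm) (HK _ Kk).
  have Hl : p (U l m - v l) < e / 3.
    exact: lt_trans (HN l _ _ Nlm (leqnn _)) (HK _ Kl).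
  have Hkl : p (U k m - U l m) < e / 3 by exact: HL Lm.
  have := sn_distl p (v k) (U k m) (v l); have := sn_distl p (U k m) (U l m) (v l).
  lra.
exists (mkcauchy vc) => e e0; have e30 : 0 < e / 3 by rewrite divr_gt0.
have [K HK] := natSinv_lt e30; have [M HM] := vc _ e30.
exists (maxn K M) => k; rewrite geq_max => /andP[Kk Mk].
apply: (@le_lt_trans _ _ (e / 3 + e / 3)); last by lra.
apply: (@lim_norm_le _ _ (maxn (N k) M)) => m; rewrite geq_max => /andP[Nm Mm].
rewrite (le_trans (sn_distl p _ (v k) _))// lerD//; last exact: ltW (HM _ _ _ _).
by apply/ltW/(lt_trans (HN k _ _ _ _)) => //; exact: HK.
Qed.

Definition completion : completeNormedModType R :=
  hausdorff (Cseminorm lim_seminorm_complete).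

Lemma cst_cauchy x : seq_cauchy p (fun=> x).
Proof. by move=> e e0; exists 0%N => m n _ _; rewrite subrr sn0. Qed.

Definition to_completion (x : E) : completion := hpi _ (mkcauchy (cst_cauchy x)).

Lemma to_completion_linear : linear to_completion.
Proof.
by move=> a x y; rewrite /to_completion -linearP; congr hpi; exact: val_inj.
Qed.

HB.instance Definition _ := GRing.isLinear.Build R E completion _
  to_completion to_completion_linear.

Lemma norm_to_completion x : `|to_completion x| = p x.
Proof.
rewrite norm_hpi; apply: (cvg_unique _ (@lim_normP (mkcauchy (cst_cauchy x)))).
  exact: norm_hausdorff.
rewrite /=; exact: (@cvg_cst R^o).
Qed.

Lemma hpi_to_completion (u : cauchy_type) :
  (fun n => to_completion (u n)) @ \oo --> (hpi _ u : completion).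
Proof.
apply/seq_limitP => e e0; have e20 : 0 < e / 2 by rewrite divr_gt0.
have [N HN] := cauchy_typeP u e20; exists N => n Nn.
rewrite /to_completion -linearB norm_hpi; apply: (@le_lt_trans _ _ (e / 2)); last by lra.
by apply: (@lim_norm_le _ _ N) => m Nm; apply/ltW/HN.
Qed.

Section extension.
Variables (Z : completeNormedModType R) (T : E -> Z) (C : R).
Hypotheses (Tl : linear T) (TC : forall x, `|T x| <= C * p x).

Let TB x y : T (x - y) = T x - T y.
Proof. by rewrite addrC -scaleN1r Tl scaleN1r addrC. Qed.

Definition ext_fun (q : completion) : Z :=
  lim ((fun n => T ((repr q : cauchy_type) n)) @ \oo).

Let pos_bound x : `|T x| <= (`|C| + 1) * p x.
Proof.
rewrite (le_trans (TC x))// ler_wpM2r ?sn_ge0//.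
by rewrite (le_trans (ler_norm C))// lerDl.
Qed.

Lemma ext_cvg (u : cauchy_type) : cvg ((fun n => T (u n)) @ \oo).
Proof.
suff [l ul] : exists l, seq_limit Num.norm (fun n => T (u n)) l.
  by apply/cvg_ex; exists l; exact/seq_limitP.
apply: complete_seq => e e0; have C0 : 0 < `|C| + 1 by rewrite ltr_wpDl.
have [N HN] := cauchy_typeP u (divr_gt0 e0 C0); exists N => m n Nm Nn.
have := HN m n Nm Nn; rewrite ltr_pdivlMr// mulrC; apply: le_lt_trans.
by rewrite -TB.
Qed.

Lemma ext_hpi (u : cauchy_type) :
  (fun n => T (u n)) @ \oo --> ext_fun (hpi _ u : completion).
Proof.
set q : completion := hpi _ u; pose r : cauchy_type := repr q.
have ru : lim_norm (r - u) = 0 by exact: (repr_hpi (Cseminorm lim_seminorm_complete) u).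
have -> : (fun n => T (u n)) = (fun n => T (r n)) \- (fun n => T ((r - u) n)).
  by apply/funext => n /=; rewrite -TB opprB addrC subrK.
rewrite -[ext_fun q]subr0; apply: cvgB; first exact: ext_cvg.
apply/cvgr0Pnorm_lt => e e0; have C0 : 0 < `|C| + 1 by rewrite ltr_wpDl.
have [N HN] : exists N, forall n, (N <= n)%N -> p ((r - u) n) < e / (`|C| + 1).
  by apply: lim_norm_lt; rewrite ru divr_gt0.
exists N => // n /HN; rewrite ltr_pdivlMr// mulrC; apply: le_lt_trans.
exact: pos_bound.
Qed.

Lemma ext_linear : linear ext_fun.
Proof.
move=> a q r; rewrite -(hpiK q) -(hpiK r) -linearP.
set u := repr q; set v := repr r.
apply: (cvg_unique _ (@ext_hpi _)); first exact: norm_hausdorff.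
rewrite (_ : (fun n => _) = (fun n => a *: T (u n) + T (v n))); last first.
  by apply/funext => n; exact: Tl.
by apply: cvgD; [apply: cvgZl_tmp; exact: ext_hpi|exact: ext_hpi].
Qed.

Lemma ext_bounded q : `|ext_fun q| <= C * `|q|.
Proof.
rewrite -(hpiK q) norm_hpi; set u := repr q.
have H : (fun n => C * p (u n) : R^o) @ \oo --> C * lim_norm u.
  exact: (cvgMl_tmp (@lim_normP u)).
apply: (ler_cvg_to (cvg_norm (@ext_hpi u)) H).
by exists 0%N => // n _; exact: TC.
Qed.

Definition extension : bop completion Z := mkbop ext_linear ext_bounded.

Lemma extensionE x : extension (to_completion x) = T x.
Proof.
apply: (cvg_unique _ (@ext_hpi (mkcauchy (cst_cauchy x)))).
  exact: norm_hausdorff.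
rewrite /=; exact: cvg_cst.
Qed.

End extension.
End completion.

Section algebraic_tensor.
Context {R : realType} (X Y : lmodType R).

Definition bilform := {bilinear X -> Y -> R^o}.

Definition tsum (s : seq (X * Y)) : bilform -> R^o :=
  fun B => \sum_(z <- s) B z.1 z.2.

(* A tensor is represented by the functional it induces on bilinear forms, with x (x) y
   acting by B |-> B x y. Bilinear forms separate the points of the algebraic tensor
   product, so equality of these functionals is equality of tensors. *)
Definition tensor_pred : {pred bilform -> R^o} := [pred u | `[< exists s, u = tsum s >]].

Lemma tensor_submod : submod_closed tensor_pred.
Proof.
split; first by apply/asboolP; exists [::]; apply/funext => B; rewrite /tsum big_nil.
move=> a u v /asboolP[s ->] /asboolP[t ->]; apply/asboolP.
exists ([seq (a *: z.1, z.2) | z <- s] ++ t); apply/funext => B.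
rewrite /tsum big_cat big_map !fctE /=; congr (_ + _).
by rewrite scaler_sumr; apply: eq_bigr => z _; rewrite linearZl_LR.
Qed.

HB.instance Definition _ :=
  GRing.isSubmodClosed.Build R (bilform -> R^o) tensor_pred tensor_submod.

Record tensor := Tensor { tensor_val :> bilform -> R^o; _ : tensor_val \in tensor_pred }.

HB.instance Definition _ := [isSub for tensor_val].
HB.instance Definition _ := [Choice of tensor by <:].
HB.instance Definition _ := [SubChoice_isSubLmodule of tensor by <:].

Lemma tensorP (u v : tensor) : (forall B, u B = v B) <-> u = v.
Proof. by split=> [uv|->//]; apply/val_inj/funext. Qed.

Lemma tensor_rep (u : tensor) : exists s, u = tsum s :> (bilform -> R^o).
Proof. by have /asboolP := valP u. Qed.

Lemma tens_subproof x y : (fun B : bilform => B x y : R^o) \in tensor_pred.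
Proof.
by apply/asboolP; exists [:: (x, y)]; apply/funext => B; rewrite /tsum big_seq1.
Qed.

Definition tens x y : tensor := Tensor (tens_subproof x y).

Lemma tensor_sumE (I : Type) (r : seq I) (F : I -> tensor) B :
  (\sum_(i <- r) F i) B = \sum_(i <- r) F i B.
Proof. by elim/big_rec2: _ => // i a b _ <-. Qed.

Lemma tensor_sum (u : tensor) : exists s : seq (X * Y), u = \sum_(z <- s) tens z.1 z.2.
Proof.
have [s us] := tensor_rep u; exists s; apply/tensorP => B.
by rewrite us tensor_sumE.
Qed.

End algebraic_tensor.

Section functional_product.
Context {R : realType} (X Y : completeNormedModType R).

Definition fprod (f : dual X) (g : dual Y) : X -> Y -> R^o := fun x y => f x * g y.

Lemma fprod_bilinear f g : bilinear_for *:%R *:%R (fprod f g).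
Proof.
split=> [y|x] a u v; rewrite /fprod /= linearP.
  by rewrite mulrDl scalerAl.
by rewrite mulrDr scalerAr.
Qed.

HB.instance Definition _ f g := bilinear_isBilinear.Build R X Y R^o _ _ (fprod f g) (fprod_bilinear f g).

End functional_product.

Section tensor_norms.
Context {R : realType} (X Y : completeNormedModType R).
Implicit Types u v : tensor X Y.

Definition tens_of (s : seq (X * Y)) : tensor X Y := \sum_(z <- s) tens z.1 z.2.

Definition cost (s : seq (X * Y)) : R := \sum_(z <- s) `|z.1| * `|z.2|.

Lemma cost_ge0 s : 0 <= cost s.
Proof. by apply: sumr_ge0 => z _; rewrite mulr_ge0. Qed.

Lemma fprod_cost (f : dual X) (g : dual Y) s :
  `|tens_of s (fprod f g)| <= `|f| * `|g| * cost s.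
Proof.
rewrite tensor_sumE (le_trans (ler_norm_sum _ _ _))// mulr_sumr; apply: ler_sum => z _.
by rewrite /= normrM mulrACA ler_pM// bop_normP.
Qed.

Definition proj_norm u : R := inf [set cost s | s in [set s | u = tens_of s]].

Lemma proj_has_inf u : has_inf [set cost s | s in [set s | u = tens_of s]].
Proof.
split; first by have [s us] := tensor_sum u; exists (cost s); exists s.
by exists 0 => _ [s _ <-]; exact: cost_ge0.
Qed.

Lemma proj_norm_le s : proj_norm (tens_of s) <= cost s.
Proof. by apply: ge_inf; [case: (proj_has_inf (tens_of s))|exists s]. Qed.

Lemma proj_norm_ge u (c : R) : (forall s, u = tens_of s -> c <= cost s) ->
  c <= proj_norm u.
Proof.
move=> H; apply: lb_le_inf; first by case: (proj_has_inf u).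
by move=> _ [s /H + <-].
Qed.

Lemma proj_norm_adherent u e : 0 < e -> exists2 s, u = tens_of s & cost s < proj_norm u + e.
Proof.
move=> e0; have : proj_norm u < proj_norm u + e by rewrite ltrDl.
by move=> /(inf_lt (proj_has_inf u).1)[_ [s us <-] se]; exists s.
Qed.

Lemma proj_norm_ge0 u : 0 <= proj_norm u.
Proof. by apply: proj_norm_ge => s _; exact: cost_ge0. Qed.

Lemma proj_normD u v : proj_norm (u + v) <= proj_norm u + proj_norm v.
Proof.
apply/ler_addgt0Pl => e e0; have e20 : 0 < e / 2 by rewrite divr_gt0.
have [s us se] := proj_norm_adherent u e20; have [t vt te] := proj_norm_adherent v e20.
have -> : u + v = tens_of (s ++ t) by rewrite /tens_of big_cat us vt.
rewrite (le_trans (proj_norm_le _))// /cost big_cat /=.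
by rewrite /cost in se te; lra.
Qed.

Lemma tens_ofZ a s : a *: tens_of s = tens_of [seq (a *: z.1, z.2) | z <- s].
Proof.
rewrite /tens_of big_map scaler_sumr; apply: eq_bigr => z _; apply/tensorP => B /=.
by rewrite linearZl_LR.
Qed.

Lemma costZ a s : cost [seq (a *: z.1, z.2) | z <- s] = `|a| * cost s.
Proof.
rewrite /cost big_map mulr_sumr; apply: eq_bigr => z _ /=.
by rewrite normrZ mulrA.
Qed.

Lemma proj_normZ_le a u : proj_norm (a *: u) <= `|a| * proj_norm u.
Proof.
have [->|a0] := eqVneq a 0.
  rewrite normr0 mul0r scale0r (_ : 0 = tens_of [::]) ?(le_trans (proj_norm_le _))//.
    by rewrite /cost big_nil.
  by rewrite /tens_of big_nil.
rewrite -ler_pdivrMl ?normr_gt0//; apply: proj_norm_ge => s ->.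
by rewrite ler_pdivrMl ?normr_gt0// tens_ofZ -costZ proj_norm_le.
Qed.

Lemma proj_normZ a u : proj_norm (a *: u) = `|a| * proj_norm u.
Proof.
apply/eqP; rewrite eq_le proj_normZ_le /=.
have [->|a0] := eqVneq a 0; first by rewrite normr0 mul0r proj_norm_ge0.
have := proj_normZ_le a^-1 (a *: u).
by rewrite scalerA mulVf// scale1r normfV ler_pdivlMl// normr_gt0.
Qed.

Definition proj_seminorm := Seminorm proj_normD proj_normZ.

(* For u = \sum_i x_i (x) y_i, [u (fprod f g)] is \sum_i f x_i * g y_i. *)
Definition inj_set u : set R :=
  [set `|u (fprod fg.1 fg.2)| | fg in [set fg : dual X * dual Y | `|fg.1| <= 1 /\ `|fg.2| <= 1]].

Definition inj_norm u : R := sup (inj_set u).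

Lemma inj_has_sup u : has_sup (inj_set u).
Proof.
split; first by exists `|u (fprod 0 0)|; exists (0, 0) => //=; rewrite !normr0.
have [s us] := tensor_sum u; exists (cost s) => _ [[f g] /= [f1 g1] <-].
rewrite us (le_trans (fprod_cost f g s))// ler_piMl ?cost_ge0//.
by rewrite mulr_ile1.
Qed.

Lemma inj_norm_le u (c : R) :
  (forall f g, `|f| <= 1 -> `|g| <= 1 -> `|u (fprod f g)| <= c) -> inj_norm u <= c.
Proof.
move=> H; apply: ge_sup; first by case: (inj_has_sup u).
by move=> _ [[f g] /= [f1 g1] <-]; exact: H.
Qed.

Lemma inj_norm_ge u f g : `|f| <= 1 -> `|g| <= 1 -> `|u (fprod f g)| <= inj_norm u.
Proof.
by move=> f1 g1; apply: (sup_upper_bound (inj_has_sup u)); exists (f, g).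
Qed.

Lemma inj_normD u v : inj_norm (u + v) <= inj_norm u + inj_norm v.
Proof.
apply: inj_norm_le => f g f1 g1.
by rewrite (le_trans (ler_normD _ _))// lerD// inj_norm_ge.
Qed.

Lemma inj_norm_ge0 u : 0 <= inj_norm u.
Proof. by apply: (le_trans _ (@inj_norm_ge u 0 0 _ _)) => //; rewrite normr0. Qed.

Lemma inj_normZ a u : inj_norm (a *: u) = `|a| * inj_norm u.
Proof.
have le b v : inj_norm (b *: v) <= `|b| * inj_norm v.
  by apply: inj_norm_le => f g f1 g1; rewrite normrM ler_wpM2l// inj_norm_ge.
apply/eqP; rewrite eq_le le /=.
have [->|a0] := eqVneq a 0; first by rewrite normr0 mul0r inj_norm_ge0.
have := le a^-1 (a *: u).
by rewrite scalerA mulVf// scale1r normfV ler_pdivlMl// normr_gt0.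
Qed.

Definition inj_seminorm := Seminorm inj_normD inj_normZ.

Lemma inj_norm_fprod u (f : dual X) (g : dual Y) :
  `|u (fprod f g)| <= inj_norm u * (`|f| * `|g|).
Proof.
have [s us] := tensor_sum u.
have [f0|f0] := eqVneq f 0.
  rewrite f0 normr0 mul0r mulr0 us tensor_sumE big1 ?normr0// => z _.
  by rewrite /= /fprod /= mul0r.
have [g0|g0] := eqVneq g 0.
  rewrite g0 normr0 !mulr0 us tensor_sumE big1 ?normr0// => z _.
  by rewrite /= /fprod /= mulr0.
have nf0 : 0 < `|f| by rewrite normr_gt0.
have ng0 : 0 < `|g| by rewrite normr_gt0.
rewrite -ler_pdivrMr ?mulr_gt0//.
have := @inj_norm_ge u (`|f|^-1 *: f) (`|g|^-1 *: g).
rewrite !normrZ !normfV !normr_id !mulVf ?gt_eqF// => /(_ (lexx _) (lexx _)).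
apply: le_trans; rewrite le_eqVlt; apply/orP; left; apply/eqP.
rewrite us !tensor_sumE -[(`|f| * `|g|)^-1]gtr0_norm ?invr_gt0 ?mulr_gt0// -normrM.
congr `|_|; rewrite mulr_suml; apply: eq_bigr => z _ /=.
by rewrite /fprod /= invfM mulrC mulrACA.
Qed.

Definition injective_tensor : completeNormedModType R := completion inj_seminorm.
Definition projective_tensor : completeNormedModType R := completion proj_seminorm.

Definition inj_tens (x : X) (y : Y) : injective_tensor :=
  to_completion inj_seminorm (tens x y).
Definition proj_tens (x : X) (y : Y) : projective_tensor :=
  to_completion proj_seminorm (tens x y).

Lemma tensDl a x x' y : tens (a *: x + x') y = a *: tens x y + tens x' y :> tensor X Y.
Proof. by apply/tensorP => B; rewrite /= linearPl. Qed.

Lemma tensDr a x y y' : tens x (a *: y + y') = a *: tens x y + tens x y' :> tensor X Y.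
Proof. by apply/tensorP => B; rewrite /= linearP. Qed.

Lemma norm_proj_tens_le x y : `|proj_tens x y| <= `|x| * `|y|.
Proof.
rewrite norm_to_completion /=.
by have := proj_norm_le [:: (x, y)]; rewrite /tens_of /cost !big_seq1.
Qed.

End tensor_norms.

Section operator_of_functional.
Context {R : realType} (X Y : completeNormedModType R).
Variable phi : dual (projective_tensor X Y).

Definition curry_val (x : X) : Y -> R^o := fun y => phi (proj_tens x y).

Lemma curry_val_linear x : linear (curry_val x).
Proof.
by move=> a y z; rewrite /curry_val /proj_tens tensDr !linearP.
Qed.

Lemma curry_val_bounded x y : `|curry_val x y| <= (`|phi| * `|x|) * `|y|.
Proof.
rewrite (le_trans (bop_normP phi _))// -mulrA ler_wpM2l//.
exact: norm_proj_tens_le.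
Qed.

Definition curry_fun (x : X) : dual Y := mkbop (curry_val_linear x) (curry_val_bounded x).

Lemma curry_linear : linear curry_fun.
Proof.
move=> a x z; apply/bopP => y.
by rewrite /= /curry_val /proj_tens tensDl !linearP.
Qed.

Lemma curry_bounded x : `|curry_fun x| <= `|phi| * `|x|.
Proof. by apply: bop_norm_le => [|y]; [rewrite mulr_ge0|exact: curry_val_bounded]. Qed.

Definition operator_of : bop X (dual Y) := mkbop curry_linear curry_bounded.

End operator_of_functional.

Section functional_of_operator.
Context {R : realType} (X Y : completeNormedModType R).
Variable T : bop X (dual Y).

Definition operator_form : X -> Y -> R^o := fun x y => T x y.

Lemma operator_form_bilinear : bilinear_for *:%R *:%R operator_form.
Proof. by split=> [y|x] a u v; rewrite /operator_form linearP. Qed.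

HB.instance Definition _ := bilinear_isBilinear.Build R X Y R^o _ _
  operator_form operator_form_bilinear.

Definition functional_val (u : tensor X Y) : R^o := u operator_form.

Lemma functional_val_linear : linear functional_val.
Proof. by []. Qed.

Lemma functional_val_bounded u : `|functional_val u| <= `|T| * proj_seminorm X Y u.
Proof.
have [T0|T0] := eqVneq T 0.
  have [s ->] := tensor_sum u; rewrite /functional_val tensor_sumE big1 => [|z _].
    by rewrite normr0 mulr_ge0// sn_ge0.
  by rewrite /= /operator_form T0.
have nT : 0 < `|T| by rewrite normr_gt0.
rewrite /= -ler_pdivrMl//; apply: proj_norm_ge => s ->; rewrite ler_pdivrMl//.
rewrite /functional_val tensor_sumE (le_trans (ler_norm_sum _ _ _))// mulr_sumr.
apply: ler_sum => z _ /=; rewrite /operator_form (le_trans (bop_normP (T z.1) z.2))//.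
by rewrite mulrA ler_wpM2r// bop_normP.
Qed.

(* The functional x (x) y |-> T x y; by [functional_ofK] and [operator_ofK] this is the
   identification of L(X, Y^* ) with the dual of the projective tensor product. *)
Definition functional_of : dual (projective_tensor X Y) :=
  extension functional_val_linear functional_val_bounded.

Lemma functional_ofE x y : functional_of (proj_tens x y) = T x y.
Proof. by rewrite /functional_of /proj_tens extensionE. Qed.

End functional_of_operator.

Section functional_operator_bijection.
Context {R : realType} (X Y : completeNormedModType R).

Lemma functional_ofK : cancel (@functional_of R X Y) (@operator_of R X Y).
Proof. by move=> T; apply/bopP => x; apply/bopP => y; exact: functional_ofE. Qed.

Lemma operator_ofK : cancel (@operator_of R X Y) (@functional_of R X Y).
Proof.
move=> phi; apply/bopP => q; rewrite -(hpiK q); set u := repr q.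
have cv (psi : dual (projective_tensor X Y)) :
    (fun n => psi (to_completion _ (u n))) @ \oo --> psi (hpi _ u).
  apply/seq_limitP => e e0; have C0 : 0 < `|psi| + 1 by rewrite ltr_wpDl.
  have /seq_limitP/(_ _ (divr_gt0 e0 C0))[N HN] := @hpi_to_completion _ _ _ u.
  exists N => n /HN; rewrite ltr_pdivlMr// mulrC -linearB; apply: le_lt_trans.
  by rewrite (le_trans (bop_normP psi _))// ler_wpM2r// lerDl.
apply: (cvg_unique _ (cv _)); first exact: norm_hausdorff.
rewrite (_ : (fun n => _) = (fun n => phi (to_completion _ (u n)))); first exact: cv.
apply/funext => n; have [s ->] := tensor_sum (u n).
rewrite !linear_sum; apply: eq_bigr => z _.
exact: (functional_ofE (operator_of phi) z.1 z.2).
Qed.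

End functional_operator_bijection.

Section canonical_operator.
Context {R : realType} (X Y : completeNormedModType R).
Local Notation XY := (injective_tensor X Y).
Local Notation XYs := (tensor (dual X) (dual Y)).

Definition pairing_form (z : tensor X Y) : dual X -> dual Y -> R^o :=
  fun f g => z (fprod f g).

Lemma pairing_form_bilinear z : bilinear_for *:%R *:%R (pairing_form z).
Proof.
have [s ->] := tensor_sum z.
split=> [g|f] a u v /=; rewrite /pairing_form !tensor_sumE scaler_sumr -big_split;
  apply: eq_bigr => w _; rewrite /= /fprod /=.
  by rewrite mulrDl scalerAl.
by rewrite mulrDr scalerAr.
Qed.

HB.instance Definition _ z := bilinear_isBilinear.Build R (dual X) (dual Y) R^o _ _
  (pairing_form z) (pairing_form_bilinear z).

Definition pairing (u : XYs) : tensor X Y -> R^o := fun z => u (pairing_form z).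

Lemma pairing_tens f g z : pairing (tens f g) z = z (fprod f g).
Proof. by []. Qed.

Lemma pairing_linear u : linear (pairing u).
Proof.
move=> a z w; have [s ->] := tensor_sum u.
rewrite /pairing !tensor_sumE scaler_sumr -big_split; exact: eq_bigr.
Qed.

Lemma pairing_bounded (u : XYs) z :
  `|pairing u z| <= proj_seminorm (dual X) (dual Y) u * inj_seminorm X Y z.
Proof.
have [z0|z0] := eqVneq (inj_norm z) 0.
  rewrite /= z0 mulr0; have [s ->] := tensor_sum u.
  rewrite /pairing tensor_sumE big1 ?normr0// => w _ /=.
  apply/eqP; rewrite -normr_le0 /pairing_form.
  by rewrite (le_trans (inj_norm_fprod _ _ _))// z0 mul0r.
have z1 : 0 < inj_norm z by rewrite lt_def z0 inj_norm_ge0.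
rewrite /= -ler_pdivrMr//; apply: proj_norm_ge => s ->.
rewrite ler_pdivrMr// /pairing tensor_sumE (le_trans (ler_norm_sum _ _ _))//.
rewrite mulr_suml; apply: ler_sum => w _ /=.
by rewrite mulrC inj_norm_fprod.
Qed.

Definition pairing_ext (u : XYs) : dual XY := extension (pairing_linear u) (pairing_bounded u).

Lemma pairing_ext_lim u (z : XY) :
  (fun n => pairing u ((repr z : cauchy_type _) n)) @ \oo --> pairing_ext u z.
Proof.
rewrite -{2}(hpiK z); exact: (ext_hpi (pairing_linear u) (pairing_bounded u)).
Qed.

Lemma pairing_ext_linear : linear pairing_ext.
Proof.
move=> a u v; apply/bopP => z.
apply: (cvg_unique _ (@pairing_ext_lim _ z)); first exact: norm_hausdorff.
rewrite (_ : (fun n => _) = (fun n =>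
    a *: pairing u ((repr z : cauchy_type _) n) + pairing v ((repr z : cauchy_type _) n)))//.
by apply: cvgD; [apply: cvgZl_tmp; exact: pairing_ext_lim|exact: pairing_ext_lim].
Qed.

Lemma pairing_ext_bounded u : `|pairing_ext u| <= 1 * proj_seminorm (dual X) (dual Y) u.
Proof.
rewrite mul1r; apply: bop_norm_le => [|z]; first exact: sn_ge0.
exact: (ext_bounded (pairing_linear u) (pairing_bounded u)).
Qed.

(* Characterized by its values on elementary tensors, [canonical_operatorE]. *)
Definition canonical_operator : bop (projective_tensor (dual X) (dual Y)) (dual XY) :=
  extension pairing_ext_linear pairing_ext_bounded.

Lemma canonical_operatorE f g x y :
  canonical_operator (proj_tens f g) (inj_tens x y) = f x * g y.
Proof.
rewrite /canonical_operator /proj_tens extensionE.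
by rewrite /pairing_ext /inj_tens extensionE.
Qed.

End canonical_operator.

Section banach_notions.
Context {R : realType}.
Implicit Types V W X : completeNormedModType R.

Definition linearly_isomorphic V W :=
  exists (T : bop V W) (S : bop W V), cancel T S /\ cancel S T.

Definition complemented V (S : set V) :=
  exists P : bop V V, (forall v, P (P v) = P v) /\ range P = S.

Definition finite_rank V W (T : bop V W) :=
  exists (n : nat) (w : 'I_n -> W),
    forall v, exists c : 'I_n -> R, T v = \sum_(i < n) c i *: w i.

Definition approximation_property V :=
  forall (K : set V) (e : R), compact K -> 0 < e ->
    exists T : bop V V, finite_rank T /\ forall x, K x -> `|T x - x| <= e.

Definition unit_ball V : set V := [set v | `|v| <= 1].

Definition weakstar_cvg X (s : nat -> dual X) (f : dual X) :=
  forall x : X, (fun n => s n x) @ \oo --> f x.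

Definition weakstar_seq_dense X (S B : set (dual X)) :=
  forall f, B f -> exists s : nat -> dual X, (forall n, S (s n)) /\ weakstar_cvg s f.

Definition weakstar_seq_compact X (B : set (dual X)) :=
  forall s : nat -> dual X, (forall n, B (s n)) ->
    exists (k : nat -> nat) (f : dual X),
      (forall m n, (m < n)%N -> (k m < k n)%N) /\ weakstar_cvg (s \o k) f.

End banach_notions.

Arguments unit_ball {R} V.

Section ideal_assignment.
Context {R : realType}.
Variable I : forall X : completeNormedModType R, set (set (dual X)).
Variable X : completeNormedModType R.

Definition assignment0 : set (bidual X) :=
  [set z | forall A, I A -> exists x : X, forall f : dual X, A f -> z f = f x].

Definition assignment_set : set (bidual X) := closure assignment0.

Lemma assignment0P a z w : assignment0 z -> assignment0 w -> assignment0 (a *: z + w).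
Proof.
move=> zI wI A IA; have [x zx] := zI A IA; have [y wy] := wI A IA.
exists (a *: x + y) => f Af; rewrite linearP.
exact: (congr2 (fun s t : R^o => a *: s + t) (zx f Af) (wy f Af)).
Qed.

Lemma assignment_setP a z w :
  assignment_set z -> assignment_set w -> assignment_set (a *: z + w).
Proof.
move=> zI wI B /nbhs_ballP[e /= e0 eB]; have e20 : 0 < e / 2 by rewrite divr_gt0.
have a0 : 0 < `|a| + 1 by rewrite ltr_wpDl.
have [z' [z'I zz']] := zI _ (nbhsx_ballx z _ (divr_gt0 e20 a0)).
have [w' [w'I ww']] := wI _ (nbhsx_ballx w _ e20).
exists (a *: z' + w'); split; first exact: assignment0P.
apply: eB; move: zz' ww'; rewrite -!ball_normE /= => zz' ww'.
rewrite opprD addrACA -scalerBr (splitr e) (le_lt_trans (ler_normD _ _))// ltrD//.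
rewrite normrZ; move: zz'; rewrite ltr_pdivlMr//; apply: le_lt_trans.
by rewrite mulrC ler_wpM2l// lerDl.
Qed.

Lemma assignment_submod : submod_closed [pred z | `[< assignment_set z >]].
Proof.
split; last by move=> a z w /asboolP zI /asboolP wI; exact/asboolP/assignment_setP.
by apply/asboolP; apply: subset_closure => A _; exists 0 => f _; rewrite linear0.
Qed.

Lemma assignment_closed : closed assignment_set.
Proof. exact: closed_closure. Qed.

Definition assignment_subspace : csubspace (bidual X) :=
  @Csubspace _ _ (Subspace assignment_submod) assignment_closed.

Definition assignment : completeNormedModType R := cs_type assignment_subspace.

(* X as a subspace of its assignment; it is closed because the canonical embedding of
   the Banach space X in its bidual is isometric. *)
Definition canonical_image : set assignment :=
  [set d | exists x : X, val d = canonical_embedding X x].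

Lemma canonical_submod : submod_closed [pred d | `[< canonical_image d >]].
Proof.
split; first by apply/asboolP; exists 0; rewrite !linear0.
move=> a d e /asboolP[x dx] /asboolP[y ey]; apply/asboolP; exists (a *: x + y).
rewrite [RHS]linearP.
exact: (congr2 (fun s t : bidual X => a *: s + t) dx ey).
Qed.

Definition canonical_subspace : subspace assignment := Subspace canonical_submod.

Definition assignment_quotient : completeNormedModType R := quotient canonical_subspace.

End ideal_assignment.

Arguments assignment {R} I X.
Arguments canonical_image {R} I X.
Arguments assignment_quotient {R} I X.

Record testing_ideal (R : realType) := TestingIdeal {
  ti_mem :> forall X : completeNormedModType R, set (set (dual X));
  ti_set0 : forall X, ti_mem (set0 : set (dual X));
  ti_subset : forall X (A B : set (dual X)), A `<=` B -> ti_mem B -> ti_mem A;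
  ti_setU : forall X (A B : set (dual X)), ti_mem A -> ti_mem B -> ti_mem (A `|` B);
  ti_countable : forall X (A : set (dual X)), countable A -> ti_mem A;
  (* [bcomp f T] is the image of f under the adjoint of T. *)
  ti_adjoint : forall (X Y : completeNormedModType R) (T : bop X Y) (A : set (dual Y)),
    ti_mem A -> ti_mem [set (bcomp f T : dual X) | f in A];
  ti_operators : forall (X Y : completeNormedModType R) (A : set (bop X (dual Y)))
      (z : bidual Y),
    ti_mem [set functional_of T | T in A] ->
    assignment_set ti_mem z ->
    ti_mem [set (bcomp z T : dual X) | T in A] }.

(* Main.v *)
(* The assignment commutes with the injective tensor product: the map sending
   x (x) y in Delta X (x) Delta Y to f (x) g |-> x f * y g extends to an isometry of
   Delta X (x) Delta Y onto Delta (X (x) Y). It takes values there by the stability of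
   the ideal under adjoints and under compositions with elements of Delta Y. Elements of
   Delta (X (x) Y) are weak-star sequentially continuous on bounded sets, hence by (b)
   they are normed by the elementary functionals f (x) g. For surjectivity, such an
   element z induces an operator U from X^* to Delta Y which by (c) maps the ball to a
   totally bounded set; composing U with a finite rank operator given by the approximation
   property approximates z by tensors \sum_i (phi_i \o U) (x) w_i, and Helly's lemma shows
   that phi_i \o U lies in Delta X. The isomorphism then follows by splitting
   Delta X = X + S X and Delta Y = Y + S Y and dividing by X (x) Y. *)
Require Import Defs.
From mathcomp Require Import all_boot all_order all_algebra.
From mathcomp Require Import all_classical all_reals all_analysis.
From mathcomp Require Import lra ring.

Set Implicit Arguments.
Unset Strict Implicit.
Unset Printing Implicit Defensive.

Import Order.TTheory GRing.Theory Num.Theory numFieldNormedType.Exports.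

Local Open Scope classical_set_scope.
Local Open Scope ring_scope.

(** The obstacle is that an element of Delta (X (x) Y) is known only through functionals on X (x) Y,
    while the injective norm of Delta X (x) Delta Y is a supremum over arbitrary functionals on the
    two assignments. For the isometry this is harmless: contracting one factor of a finite sum by an
    arbitrary functional leaves an element of a bidual, whose norm is already computed on [dual X]
    or [dual Y]. For surjectivity it matters. A finite rank operator on Delta Y has coefficients
    phi_i that need not be evaluations at points of [dual Y], so phi_i \o U has no evident reason to
    come from Delta X. Total boundedness of the image of the ball therefore serves twice: it makes
    the approximation property applicable, and it lets evaluations replace phi_i uniformly on that
    image, with a norm limit taken at the end because the assignment is norm closed. *)

(** * The Hahn-Banach theorem through minimal sublinear functionals *)

Section hahn_banach.
Context {R : realType}.

Section sublinear.
Variable V : lmodType R.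

Definition sublinear (q : V -> R) :=
  (forall x y, q (x + y) <= q x + q y) /\
  (forall t x, 0 < t -> q (t *: x) = t * q x).

Lemma sublinear0 q : sublinear q -> q 0 = 0.
Proof.
by move=> [_ qZ]; have := qZ 2 0 (ltr0n _ 2); rewrite scaler0; lra.
Qed.

Lemma sublinear_ge q x : sublinear q -> - q (- x) <= q x.
Proof.
by move=> qs; have := qs.1 x (- x); rewrite subrr sublinear0//; lra.
Qed.

Lemma inf_family_le (I : Type) (F : I -> V -> R) (L : V -> R) x i :
  (forall i x, L x <= F i x) -> inf [set F i x | i in setT] <= F i x.
Proof.
by move=> FL; apply: ge_inf; [exists (L x) => _ [j _ <-]; exact: FL|exists i].
Qed.

Lemma inf_family_ge (I : Type) (F : I -> V -> R) x c (i0 : I) :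
  (forall i, c <= F i x) -> c <= inf [set F i x | i in setT].
Proof.
by move=> Fc; apply: lb_le_inf; [exists (F i0 x); exists i0|move=> _ [i _ <-]].
Qed.

(** The index on the left may depend on the points and indices on the right. This covers both the
    multiples of [y] in [sharpen] and the members of a chain in [minimal_minorant]; [L] keeps the
    infima finite. *)
Lemma sublinear_inf (I : Type) (i0 : I) (F : I -> V -> R) (L : V -> R) :
  (forall i x, L x <= F i x) ->
  (forall i j x y, exists k, F k (x + y) <= F i x + F j y) ->
  (forall i t x, 0 < t -> exists k, F k (t *: x) <= t * F i x) ->
  sublinear (fun x => inf [set F i x | i in setT]).
Proof.
move=> FL FD FZ.
have Fle x i := inf_family_le x i FL.
have le t x : 0 < t ->
    inf [set F i (t *: x) | i in setT] <= t * inf [set F i x | i in setT].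
  move=> t0; rewrite -ler_pdivrMl//; apply: inf_family_ge => // i.
  by rewrite ler_pdivrMl//; have [k] := FZ i t x t0; apply: le_trans; exact: Fle.
split=> [x y|t x t0].
  rewrite -lerBlDr; apply: inf_family_ge => // i; rewrite lerBlDr -lerBlDl.
  apply: inf_family_ge => // j; rewrite lerBlDl.
  by have [k] := FD i j x y; apply: le_trans; exact: Fle.
apply/eqP; rewrite eq_le le//=.
have := le t^-1 (t *: x); rewrite invr_gt0 => /(_ t0).
by rewrite scalerA mulVf ?gt_eqF// scale1r ler_pdivlMl.
Qed.

(* The largest sublinear functional below [q] whose value at [- y] is at most [- q y]. *)
Definition sharpen (q : V -> R) (y x : V) : R :=
  inf [set q (x + `|t| *: y) - `|t| * q y | t in [set: R]].

(** Subadditivity at [x + |t| *: y] and [- x]. The bound does not depend on [t], so the infimum in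
    [sharpen] is finite; nonnegative multiples are written [|t|] to let the index range over all of
    [R]. *)
Lemma sharpen_bound q y (t : R) x : sublinear q ->
  - q (- x) <= q (x + `|t| *: y) - `|t| * q y.
Proof.
move=> qs; have ty : q (`|t| *: y) = `|t| * q y.
  have [->|t0] := eqVneq `|t| 0; first by rewrite scale0r mul0r sublinear0.
  by apply: qs.2; rewrite lt_def t0 /=.
rewrite -ty; have := qs.1 (x + `|t| *: y) (- x).
by rewrite addrAC subrr add0r; lra.
Qed.

Lemma sharpen_le q y x (t : R) : sublinear q ->
  sharpen q y x <= q (x + `|t| *: y) - `|t| * q y.
Proof.
move=> qs; apply: (@inf_family_le _ (fun (t : R) z =>
  q (z + `|t| *: y) - `|t| * q y) (fun z => - q (- z))) => i z.
exact: sharpen_bound.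
Qed.

Lemma sharpen_sublinear q y : sublinear q -> sublinear (sharpen q y).
Proof.
move=> qs; apply: (@sublinear_inf _ 0 (fun (t : R) x =>
  q (x + `|t| *: y) - `|t| * q y) (fun x => - q (- x))).
- by move=> i z; exact: sharpen_bound.
- move=> s t x z; exists (`|s| + `|t|) => /=.
  rewrite ger0_norm ?addr_ge0// scalerDl addrACA.
  by have := qs.1 (x + `|s| *: y) (z + `|t| *: y); lra.
- move=> s t x t0; exists (t * `|s|).
  rewrite normrM normr_id (gtr0_norm t0) -scalerA -scalerDr qs.2//.
  by rewrite mulrBr mulrA.
Qed.

Definition minorant (p : V -> R) := {q : V -> R | sublinear q /\ forall x, q x <= p x}.

Lemma minorant_lower p (q : minorant p) x : - p (- x) <= sval q x.
Proof.
case: q => q [qs qp] /=; apply: (le_trans _ (sublinear_ge x qs)).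
by rewrite lerN2.
Qed.

(** Zorn's lemma for the reversed pointwise order. A chain is bounded by its pointwise infimum,
    which is finite because every sublinear functional below [p] lies above [x |-> - p (- x)]. *)
Lemma minimal_minorant p : sublinear p -> exists m : minorant p,
  forall q : minorant p, (forall x, sval q x <= sval m x) -> sval q = sval m.
Proof.
move=> ps; pose ge (q r : minorant p) : bool := `[< forall x, sval r x <= sval q x >].
have p0 : minorant p by exists p; split.
have [|||m mm] := @ZL_preorder _ p0 ge.
- by move=> q; apply/asboolP => x.
- move=> q r s /asboolP qr /asboolP rs; apply/asboolP => x.
  exact: le_trans (rs x) (qr x).
- move=> A tot.
  have [[q0 Aq0]|nA] := pselect (exists q, A q); last first.
    by exists p0 => q Aq; case: nA; exists q.
  pose I := {q | A q}; pose F (i : I) := sval (sval i).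
  pose L x := - p (- x).
  have FL i x : L x <= F i x by exact: minorant_lower.
  pose m x := inf [set F i x | i in setT].
  have ms : sublinear m.
    apply: (@sublinear_inf I (exist _ q0 Aq0) F L FL) => [[q Aq] [r Ar] x y|i t x t0].
      have [/asboolP qr|/asboolP rq] := tot _ _ Aq Ar.
        exists (exist _ r Ar); rewrite /F /= (le_trans ((svalP r).1.1 _ _))//.
        by rewrite lerD2r.
      exists (exist _ q Aq); rewrite /F /= (le_trans ((svalP q).1.1 _ _))//.
      by rewrite lerD2l.
    by exists i; rewrite /F (svalP (sval i)).1.2.
  have mp x : m x <= p x.
    apply: (le_trans (inf_family_le x (exist _ q0 Aq0 : I) FL)).
    exact: (svalP q0).2.
  exists (exist _ m (conj ms mp)) => q Aq; apply/asboolP => x.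
  exact: (inf_family_le x (exist _ q Aq : I) FL).
exists m => q qm; apply/funext => x; apply/eqP; rewrite eq_le qm/=.
have : ge m q by exact/asboolP.
by move/mm => /asboolP.
Qed.

(** A minimal [m] equals each of its sharpenings, and sharpening at [y] forces [m (- y) <= - m y].
    Hence [m] is odd, and an odd sublinear functional is linear. *)
Lemma linear_minorant p : sublinear p ->
  exists f : V -> R, linear (f : V -> R^o) /\ forall x, f x <= p x.
Proof.
move=> ps; have [[m [ms mp]] /= mm] := minimal_minorant ps.
have odd y : m (- y) = - m y.
  apply/eqP; rewrite eq_le; apply/andP; split; last first.
    by have := sublinear_ge (- y) ms; rewrite opprK.
  have le x : sharpen m y x <= m x.
    have := sharpen_le y x 0 ms.
    by rewrite normr0 scale0r addr0 mul0r subr0.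
  have mp' x : sharpen m y x <= p x by exact: le_trans (le x) (mp x).
  have /= sm := mm (exist _ _ (conj (sharpen_sublinear y ms) mp')) le.
  have := sharpen_le y (- y) 1 ms.
  by rewrite sm normr1 scale1r addNr mul1r sublinear0// sub0r.
exists m; split=> // a x y.
have D u v : m (u + v) = m u + m v.
  apply/eqP; rewrite eq_le ms.1/= -lerN2 -odd opprD.
  by rewrite (le_trans (ms.1 _ _))// !odd opprD.
rewrite D; congr (_ + _).
have [->|a0] := eqVneq a 0; first by rewrite !scale0r sublinear0.
have [an|ap] := ltP a 0; last by apply: ms.2; rewrite lt_def a0.
by rewrite -[a]opprK scaleNr odd ms.2 ?oppr_gt0// scaleNr.
Qed.

End sublinear.

(** Sharpening the norm at [v] before taking a linear minorant forces [f (- v) <= - |v|]; this takes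
    the place of extending a functional from the line through [v]. *)
Lemma norming_functional (V : completeNormedModType R) (v : V) :
  exists f : dual V, `|f| <= 1 /\ f v = `|v|.
Proof.
have ns : sublinear (fun x : V => `|x|).
  by split=> [x y|t x t0]; [exact: ler_normD|rewrite normrZ gtr0_norm].
have [f [fl fp]] := linear_minorant (sharpen_sublinear v ns).
have fn x : f x <= `|x|.
  have := sharpen_le v x 0 ns; rewrite normr0 scale0r addr0 mul0r subr0.
  exact: le_trans.
have fl' x : `|f x| <= 1 * `|x|.
    rewrite mul1r ler_norml fn andbT lerNl.
    have -> : - f x = f (- x).
      have f0 : f 0 = 0 by have := fl 1 0 0; rewrite !scale1r addr0; lra.
      by have := fl (-1) x 0; rewrite !addr0 scaleN1r f0 addr0 scaleN1r.
    by rewrite -(normrN x).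
exists (mkbop fl fl'); split; first exact: bop_norm_le.
apply/eqP; rewrite eq_le fn/=.
have := fp (- v); have := sharpen_le v (- v) 1 ns.
rewrite normr1 scale1r addNr normr0 mul1r sub0r => h1 h2.
have := le_trans h2 h1; rewrite -[f (- v)]/(mkbop fl fl' (- v)) linearN /=.
by rewrite lerN2.
Qed.

End hahn_banach.

(** * Bounded operators, finite rank operators and completions *)

Section operator_arithmetic.
Context {R : realType} (V W : normedModType R).
Implicit Types f g : bop V W.

Lemma bopD f g x : (f + g) x = f x + g x. Proof. by []. Qed.

Lemma bopB f g x : (f - g) x = f x - g x. Proof. by []. Qed.

Lemma bopZ a f x : (a *: f) x = a *: f x. Proof. by []. Qed.

Lemma bop0r f : f 0 = 0. Proof. exact: linear0. Qed.

Lemma bopNr f x : f (- x) = - f x. Proof. exact: linearN. Qed.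

Lemma bopBr f x y : f (x - y) = f x - f y. Proof. exact: linearB. Qed.

Lemma bopDr f x y : f (x + y) = f x + f y. Proof. exact: linearD. Qed.

Lemma bopZr f a x : f (a *: x) = a *: f x. Proof. exact: linearZ. Qed.

Lemma bop_sum (I : Type) (r : seq I) (F : I -> bop V W) x :
  (\sum_(i <- r) F i) x = \sum_(i <- r) F i x.
Proof. by elim/big_rec2: _ => // i a b _ <-. Qed.

Lemma bop_sumr (I : Type) (r : seq I) f (F : I -> V) :
  f (\sum_(i <- r) F i) = \sum_(i <- r) f (F i).
Proof. exact: linear_sum. Qed.

Lemma bop_norm_ball f (x : V) : `|f| <= 1 -> `|f x| <= `|x|.
Proof. by move=> f1; rewrite (le_trans (bop_normP f x))// ler_piMl. Qed.

Lemma bop_norm_ball_le f (C : R) : 0 <= C ->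
  (forall x, `|x| <= 1 -> `|f x| <= C) -> `|f| <= C.
Proof.
move=> C0 fC; apply: bop_norm_le => // x.
have [->|x0] := eqVneq x 0; first by rewrite linear0 !normr0 mulr0.
have nx0 : 0 < `|x| by rewrite normr_gt0.
have := fC (`|x|^-1 *: x).
rewrite linearZ/= !normrZ normfV normr_id mulVf ?gt_eqF// => /(_ (lexx _)).
by rewrite ler_pdivrMl// mulrC.
Qed.

End operator_arithmetic.

Section banach_space_lemmas.
Context {R : realType}.
Implicit Types V W : completeNormedModType R.

Lemma bcompE V W (U : completeNormedModType R) (g : bop W U) (f : bop V W) x :
  bcomp g f x = g (f x).
Proof. by []. Qed.

Lemma bcomp_norm V W (U : completeNormedModType R) (g : bop W U) (f : bop V W) :
  `|bcomp g f| <= `|g| * `|f|.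
Proof. by apply: bop_norm_le => [|x]; [rewrite mulr_ge0|exact: bcomp_bounded]. Qed.

Lemma norm_le_dual V (v : V) (c : R) :
  (forall f : dual V, `|f| <= 1 -> `|f v| <= c) -> `|v| <= c.
Proof.
move=> vc; have [f [f1 fv]] := norming_functional v.
by have := vc f f1; rewrite fv normr_id.
Qed.

Lemma norm_canonical_embedding V (v : V) : `|canonical_embedding V v| = `|v|.
Proof.
apply/eqP; rewrite eq_le; apply/andP; split.
  by apply: bop_norm_le => // f; exact: (evalb_bounded v f).
apply: norm_le_dual => f f1.
rewrite (le_trans (bop_normP (canonical_embedding V v) f))//.
by rewrite ler_piMr.
Qed.

Lemma norm_small_eq0 V (v : V) : (forall e, 0 < e -> `|v| <= e) -> v = 0.
Proof.
move=> H; apply/eqP; rewrite -normr_le0; apply/ler_addgt0Pr => e e0.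
by rewrite add0r H.
Qed.

(** Approximate preimages of a point form a Cauchy sequence because [T] is isometric, so the dense
    range is everything. *)
Lemma isometric_dense_iso V W (T : bop V W) :
  (forall v, `|T v| = `|v|) ->
  (forall w e, 0 < e -> exists v, `|T v - w| <= e) ->
  exists S : bop W V, cancel T S /\ cancel S T.
Proof.
move=> Tn Td.
have Tinj v v' : T v = T v' -> v = v'.
  move=> vv'; apply/eqP; rewrite -subr_eq0 -normr_eq0 -Tn bopBr.
  by rewrite vv' subrr normr0.
have surj w : exists v, T v = w.
  have inv0 n : 0 < n.+1%:R^-1 :> R by rewrite invr_gt0 ltr0n.
  have /choice[v vw] := fun n : nat => Td w _ (inv0 n).
  have vwe e : 0 < e -> exists N, forall n, (N <= n)%N -> `|T (v n) - w| < e.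
    by move=> /natSinv_lt[N HN]; exists N => n Nn; exact: le_lt_trans (vw n) (HN n Nn).
  have [l vl] : exists l, seq_limit Num.norm v l.
    apply: complete_seq => e e0; have e20 : 0 < e / 2 by rewrite divr_gt0.
    have [N HN] := vwe _ e20; exists N => m n Nm Nn.
    rewrite -Tn bopBr -(subrKA w) (splitr e) (le_lt_trans (ler_normD _ _))// ltrD//.
      exact: HN.
    by rewrite distrC HN.
  exists l; apply/eqP; rewrite -subr_eq0; apply/eqP/norm_small_eq0 => e e0.
  have e20 : 0 < e / 2 by rewrite divr_gt0.
  have [N HN] := vwe _ e20; have [M HM] := vl _ e20.
  rewrite -(subrKA (T (v (maxn N M)))) (splitr e) (le_trans (ler_normD _ _))// lerD//.
    by rewrite -bopBr Tn distrC ltW// HM// leq_maxr.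
  by rewrite ltW// HN// leq_maxl.
have /choice[S TS] := surj.
have Sl : linear S by move=> a x y; apply: Tinj; rewrite bopDr bopZr !TS.
have SC w : `|S w| <= 1 * `|w| by rewrite mul1r -Tn TS.
exists (mkbop Sl SC); split; first by move=> v; apply: Tinj; exact: TS.
exact: TS.
Qed.

Definition rank_sum V W (s : seq (dual V * W)) (v : V) : W :=
  \sum_(z <- s) z.1 v *: z.2.

Lemma rank_sum_linear V W (s : seq (dual V * W)) : linear (rank_sum s).
Proof.
move=> a x y; rewrite /rank_sum scaler_sumr -big_split; apply: eq_bigr => z _ /=.
by rewrite bopDr bopZr scalerDl scalerA.
Qed.

(* Each step adds to [v |-> rank_sum s v] a rank one correction along [w - rank_sum s w]
   that vanishes on the fixed points of [rank_sum s]. *)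
Lemma rank_sum_fixes W (ws : seq W) :
  exists s : seq (dual W * W), forall w, w \in ws -> rank_sum s w = w.
Proof.
elim: ws => [|w ws [s IH]]; first by exists [::].
set Q := rank_sum s; pose w' := w - Q w.
have [w'0|w'0] := eqVneq w' 0.
  exists s => x; rewrite inE => /predU1P[->|/IH//].
  by apply/esym/eqP; rewrite -subr_eq0; exact/eqP.
have [f [_ fw']] := norming_functional w'.
have fw0 : f w' != 0 by rewrite fw' normr_eq0.
pose g : dual W := (f w')^-1 *: (f - \sum_(z <- s) f z.2 *: z.1).
have gE v : g v = (f w')^-1 * f (v - Q v).
  have -> : f (v - Q v) = f v - \sum_(z <- s) f z.2 *: z.1 v.
    rewrite bopBr /Q /rank_sum bop_sumr; congr (_ - _); apply: eq_bigr => z _.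
    by rewrite bopZr; exact: mulrC.
  by rewrite /g bopZ bopB bop_sum.
exists ((g, w') :: s) => x; rewrite inE.
have -> : rank_sum ((g, w') :: s) x = g x *: w' + Q x by rewrite /rank_sum big_cons.
rewrite gE => /predU1P[->|/IH xQ].
  by rewrite -/w' mulVf// scale1r /w' subrK.
by rewrite (xQ : Q x = x) subrr linear0 mulr0 scale0r add0r.
Qed.

(** [finite_rank] gives coefficients that depend on [v] in no controlled way. Composing [T] with a
    finite rank operator that fixes the vectors [w i] makes them bounded functionals. *)
Lemma finite_rank_sum V W (T : bop V W) : finite_rank T ->
  exists s : seq (dual V * W), forall v, T v = rank_sum s v.
Proof.
move=> [n [w Tw]]; have [s sw] := rank_sum_fixes (codom w).
exists [seq (bcomp z.1 T, z.2) | z <- s] => v.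
transitivity (rank_sum s (T v)); last by rewrite /rank_sum big_map.
have [c ->] := Tw v.
elim/big_rec: _ => [|i a _ ea].
  by rewrite /rank_sum big1// => z _; rewrite linear0 scale0r.
by rewrite rank_sum_linear -ea (sw (w i)) ?codom_f.
Qed.

End banach_space_lemmas.

Section completion_lemmas.
Context {R : realType} (E : lmodType R) (p : seminorm E).

Lemma to_completion_dense (q : completion p) (e : R) : 0 < e ->
  exists x, `|to_completion p x - q| < e.
Proof.
move=> e0; rewrite -(hpiK q).
have /seq_limitP/(_ e e0)[N HN] := @hpi_to_completion R E p (repr q).
by exists ((repr q : cauchy_type p) N); exact: HN.
Qed.

Lemma completion_norm_le (W : completeNormedModType R) (T : bop (completion p) W) (C : R) :
  0 <= C -> (forall x, `|T (to_completion p x)| <= C * p x) -> forall q, `|T q| <= C * `|q|.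
Proof.
move=> C0 TC q; apply/ler_addgt0Pr => e e0.
have D0 : 0 < C + `|T| + 1 by rewrite ltr_wpDl// addr_ge0.
have [x xq] := to_completion_dense q (divr_gt0 e0 D0).
have Tx : `|T q| <= `|T (to_completion p x)| + `|T| * `|to_completion p x - q|.
  rewrite -{1}(subKr (to_completion p x) q) bopBr.
  by rewrite (le_trans (ler_normB _ _))// lerD2l bop_normP.
have px : p x <= `|q| + `|to_completion p x - q|.
  rewrite -norm_to_completion -{1}(subrK q (to_completion p x)) addrC.
  exact: ler_normD.
have := TC x; have := ler_wpM2l C0 px.
move: xq; rewrite ltr_pdivlMr// mulrDr mulrDr mulr1.
have := normr_ge0 (to_completion p x - q); lra.
Qed.

Lemma completion_norm_ge (W : completeNormedModType R) (T : bop (completion p) W) :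
  (forall x, p x <= `|T (to_completion p x)|) -> forall q, `|q| <= `|T q|.
Proof.
move=> TC q; apply/ler_addgt0Pr => e e0.
have D0 : 0 < `|T| + 1 by rewrite ltr_wpDl.
have [x xq] := to_completion_dense q (divr_gt0 e0 D0).
have Tx : `|T (to_completion p x)| <= `|T q| + `|T| * `|to_completion p x - q|.
  rewrite -{1}(subrK q (to_completion p x)) bopDr addrC.
  by rewrite (le_trans (ler_normD _ _))// lerD2l bop_normP.
have qx : `|q| <= p x + `|to_completion p x - q|.
  rewrite -norm_to_completion -{1}(subKr (to_completion p x) q).
  exact: ler_normB.
have := TC x; move: xq; rewrite ltr_pdivlMr// mulrDr mulr1; lra.
Qed.

Lemma completion_bop_eq (W : completeNormedModType R) (T S : bop (completion p) W) :
  (forall x, T (to_completion p x) = S (to_completion p x)) -> T = S.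
Proof.
move=> TS; apply/bopP => q; apply/eqP; rewrite -subr_eq0 -bopB -normr_le0.
have := @completion_norm_le W (T - S) 0 (lexx _) _ q; rewrite mul0r; apply => x.
by rewrite bopB TS subrr normr0 mul0r.
Qed.

End completion_lemmas.

(** * Helly's lemma *)

Section helly.
Context {R : realType} (W : completeNormedModType R).

(** The one-sided bound suffices because the ball is symmetric; [helly] uses it to turn a
    variational inequality into a norm bound. *)
Lemma functional_norm_le (y : dual W) (C K : R) : 0 <= C ->
  (forall g, `|g| <= C -> y g <= K) -> C * `|y| <= K.
Proof.
move=> C0 yK; have K0 : 0 <= K by rewrite -(bop0r y) yK// normr0.
have [->|C1] := eqVneq C 0; first by rewrite mul0r.
have C2 : 0 < C by rewrite lt_def C1.
rewrite -ler_pdivlMl//; apply: bop_norm_ball_le => [|g g1].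
  by rewrite mulr_ge0// invr_ge0.
have yC h : `|h| <= 1 -> C * y h <= K.
  move=> h1; rewrite -[C * _]/(C *: (y h : R^o)) -bopZr; apply: yK.
  by rewrite normrZ ger0_norm// ler_piMr.
rewrite ler_pdivlMl// -[C]ger0_norm// -normrM ler_norml yC// andbT lerNl -mulrN.
by rewrite -bopNr yC// normrN.
Qed.

(* A near minimizer [g0] of [\sum_i (c i - y i g)^2] over the ball satisfies the
   variational inequality [\sum_i a i * y i (g - g0) <= e^2] with [a i = c i - y i g0]. *)
Lemma helly (n : nat) (y : 'I_n -> dual W) (c : 'I_n -> R) (C e : R) : 0 <= C ->
  (forall a : 'I_n -> R, \sum_i a i * c i <= C * `|\sum_i a i *: y i|) -> 0 < e ->
  exists g : W, `|g| <= C /\ forall i, `|c i - y i g| <= e.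
Proof.
move=> C0 yc e0.
pose D g := \sum_i (c i - y i g) ^+ 2.
pose N := \sum_i (`|y i| * (C + C)) ^+ 2.
have N0 : 0 <= N by apply: sumr_ge0 => i _; exact: sqr_ge0.
have D0 g : 0 <= D g by apply: sumr_ge0 => i _; exact: sqr_ge0.
have e20 : 0 < e ^+ 2 by rewrite exprn_gt0.
(* [t] is the step from [g0] towards [g], at most 1 to stay in the ball. With [g0] minimal up to
   [t ^+ 2], comparing [D] at both ends gives [2 * Y (g - g0) <= t * (1 + N)], and [t] is chosen to
   make this at most [2 * e ^+ 2]. *)
have [t [t0 t1 te]] : exists t : R, [/\ 0 < t, t <= 1 & t * (1 + N) <= 2 * e ^+ 2].
  exists (Num.min 1 (2 * e ^+ 2 / (1 + N))).
  have N1 : 0 < 1 + N by rewrite ltr_pwDl.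
  split; first by rewrite lt_min ltr01 divr_gt0// mulr_gt0.
    by rewrite ge_min lexx.
  by rewrite -ler_pdivlMr// ge_min lexx orbT.
have Di : has_inf [set D g | g in [set g : W | `|g| <= C]].
  split; first by exists (D 0); exists 0 => //=; rewrite normr0.
  by exists 0 => _ [g _ <-].
have [_ [g0 /= g0C <-] Dg0] : exists2 r, [set D g | g in [set g : W | `|g| <= C]] r &
    r < inf [set D g | g in [set g : W | `|g| <= C]] + t ^+ 2.
  apply: inf_lt; first by case: Di.
  by rewrite ltrDl exprn_gt0.
pose a i := c i - y i g0; pose Y := \sum_i a i *: y i.
have YE g : Y g = \sum_i a i * y i g by rewrite /Y bop_sum.
have Yvar g : `|g| <= C -> Y g <= Y g0 + e ^+ 2.
  move=> gC; pose h := g - g0.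
  have hC : `|h| <= C + C by rewrite (le_trans (ler_normB _ _))// lerD.
  have hN : \sum_i (y i h) ^+ 2 <= N.
    apply: ler_sum => i _; rewrite -[leLHS]real_normK ?num_real//.
    rewrite ler_pXn2r ?nnegrE ?mulr_ge0 ?addr_ge0//.
    by rewrite (le_trans (bop_normP (y i) h))// ler_wpM2l.
  have ghC : `|g0 + t *: h| <= C.
    have -> : g0 + t *: h = (1 - t) *: g0 + t *: g.
      by rewrite /h scalerBr scalerBl scale1r addrCA addrC.
    rewrite (le_trans (ler_normD _ _))// !normrZ (ger0_norm (ltW t0)).
    rewrite ger0_norm ?subr_ge0//.
    have := ler_wpM2l (ltW t0) gC.
    have : (1 - t) * `|g0| <= (1 - t) * C by rewrite ler_wpM2l// subr_ge0.
    by lra.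
  have Dh : D (g0 + t *: h) = D g0 - 2 * t * Y h + t ^+ 2 * \sum_i (y i h) ^+ 2.
    rewrite YE /D !mulr_sumr -sumrB -big_split; apply: eq_bigr => i _ /=.
    rewrite bopDr bopZr /a -[_ *: _]/(t * _).
    by rewrite !expr2; ring.
  have Dle : inf [set D g | g in [set g : W | `|g| <= C]] <= D (g0 + t *: h).
    by apply: ge_inf; [case: Di|exists (g0 + t *: h)].
  have := ler_wpM2l (ltW (exprn_gt0 2 t0)) hN.
  have Yh : Y h = Y g - Y g0 by rewrite bopBr.
  have : 2 * t * Y h <= t ^+ 2 * (1 + N).
    by move: Dle Dg0; rewrite Dh; have := ler_wpM2l (ltW (exprn_gt0 2 t0)) hN; lra.
  move=> h1 _; have : t * (2 * Y h) <= t * (t * (1 + N)) by move: h1; rewrite expr2; lra.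
  by rewrite ler_pM2l// Yh; move: te; lra.
have YC := functional_norm_le C0 Yvar.
exists g0; split=> // i.
(* The hypothesis at these very coefficients gives [\sum_i a i * c i <= C * |Y| <= Y g0 + e ^+ 2],
   and [\sum_i a i * c i - Y g0] is the sum of squares. *)
have a2 : \sum_j a j ^+ 2 <= e ^+ 2.
  have := yc a; rewrite -/Y => /le_trans/(_ YC).
  rewrite YE addrC -lerBlDr -sumrB; apply: le_trans.
  by apply: ler_sum => j _; rewrite -mulrBr expr2.
have : a i ^+ 2 <= e ^+ 2.
  by apply: le_trans a2; rewrite (bigD1 i)//= lerDl sumr_ge0// => j _; exact: sqr_ge0.
rewrite -[a i ^+ 2]real_normK ?num_real// ler_pXn2r ?nnegrE// ?(ltW e0)//.
Qed.

End helly.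

(** * Totally bounded sets *)

Section total_boundedness.
Context {R : realType} (V : completeNormedModType R).

Definition tot_bounded (A : set V) := forall e : R, 0 < e ->
  exists s : seq V, {in s, forall y, A y} /\
    forall x, A x -> exists2 y, y \in s & `|x - y| < e.

(** If some [e] admits no finite net, points of [A] can be picked successively at mutual distance at
    least [e], and no subsequence of them is Cauchy. *)
Lemma seq_tot_bounded (A : set V) :
  (forall u : nat -> V, (forall n, A (u n)) ->
     exists k : nat -> nat, (forall m n, (m < n)%N -> (k m < k n)%N) /\
       seq_cauchy Num.norm (u \o k)) -> tot_bounded A.
Proof.
move=> Ac e e0; apply: contrapT => nnet.
have /choice[pick pickP] : forall s : seq V, exists x, {in s, forall y, A y} ->
    A x /\ {in s, forall y, e <= `|x - y|}.
  move=> s; apply: contrapT => /forallNP np; apply: nnet; exists s.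
  have sA : {in s, forall y, A y}.
    (* For [s] not contained in [A] the implication is vacuous, at 0 for instance, so its failure
       forces [s] into [A]. *)
    by apply: contrapT => sA; apply: (np 0).
  split=> // x Ax; apply: contrapT => nx; apply: (np x) => _; split=> // y ys.
  by rewrite leNgt; apply/negP => xy; apply: nx; exists y.
pose fix s n : seq V := if n is n'.+1 then pick (s n') :: s n' else [::].
have sA n : {in s n, forall y, A y}.
  elim: n => [//|n IH] y; rewrite inE => /predU1P[->|/IH//].
  by have [] := pickP _ IH.
have smem m n : (m < n)%N -> pick (s m) \in s n.
  elim: n => // n IH; rewrite ltnS leq_eqVlt inE => /predU1P[->|/IH->].
    by rewrite eqxx.
  by rewrite orbT.
have [k [kmono]] := Ac (fun n => pick (s n)) (fun n => (pickP _ (sA n)).1).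
move=> /(_ e e0)[N /(_ N.+1 N (leqnSn N) (leqnn N))] /=.
rewrite ltNge => /negP; apply.
by apply: (pickP _ (sA _)).2; apply/smem/kmono.
Qed.

(** A net of radius [e / 2] for [A] covers the closure by finitely many balls of radius [e]. An
    ultrafilter contains one of them, hence is Cauchy. *)
Lemma tot_bounded_compact (A : set V) : tot_bounded A -> compact (closure A).
Proof.
move=> At; rewrite compact_ultra => F FU FA.
have Fc : cauchy F.
  apply/cauchyP => e e0; have e20 : 0 < e / 2 by rewrite divr_gt0.
  have [s [_ sA]] := At _ e20.
  have : F [set x | exists2 y, y \in s & ball y e x].
    apply: filterS FA => x Ax.
    have [z [/sA[y ys zy]]] := Ax _ (nbhsx_ballx x _ e20).
    rewrite -ball_normE /= => xz; exists y => //.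
    rewrite distrC -(subrKA z) (splitr e).
    by rewrite (le_lt_trans (ler_normD _ _))// ltrD.
  elim: s {sA} => [|y s IH] Fs.
    have F0 : F set0 by apply: filterS Fs => x [].
    by have [] := @filter_not_empty _ F _ F0.
  have [Fy|Fy] := in_ultra_setVsetC (ball y e) FU; first by exists y.
  apply: IH; apply: filterS (filterI Fs Fy) => x [[z]].
  by rewrite inE => /predU1P[-> //|zs xz] _; exists z.
have Fcvg : cvg F by exact: cauchy_cvg.
have [l Fl] := (cvg_ex F).1 Fcvg.
exists l; split=> //; apply: (@closed_closure _ A) => B /Fl FB.
by have [x Bx] := filter_ex (filterI FA FB); exists x.
Qed.

End total_boundedness.

(** * Compact operators into closed subspaces of a bidual *)

Section closed_subspace_inclusion.
Context {R : realType} (V : completeNormedModType R) (S : csubspace V).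

Lemma cs_incl_linear : linear (fun x : cs_type S => val x).
Proof. by []. Qed.

Lemma cs_val_linear a (x y : cs_type S) : val (a *: x + y) = a *: val x + val y.
Proof. by []. Qed.

Lemma cs_valB (x y : cs_type S) : val (x - y) = val x - val y. Proof. by []. Qed.

Lemma cs_val_sum (J : Type) (r : seq J) (F : J -> cs_type S) :
  val (\sum_(i <- r) F i) = \sum_(i <- r) val (F i).
Proof. by elim/big_rec2: _ => // i a b _ <-. Qed.

Lemma cs_incl_bounded (x : cs_type S) : `|val x| <= 1 * `|x|.
Proof. by rewrite mul1r cs_normE. Qed.

Definition cs_incl : bop (cs_type S) V := mkbop cs_incl_linear cs_incl_bounded.

Lemma cs_inclE x : cs_incl x = val x. Proof. by []. Qed.

Definition cs_mk (v : V) (Sv : ss_set S v) : cs_type S :=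
  CsType (introT (asboolP _) Sv : v \in cs_pred S).

Lemma cs_val_eq (x y : cs_type S) : val x = val y -> x = y.
Proof. exact: val_inj. Qed.

Lemma cs_approx (v : V) : (forall e, 0 < e -> exists2 w, ss_set S w & `|v - w| < e) ->
  ss_set S v.
Proof.
move=> vS; apply: (@cs_closed _ _ S) => B /nbhs_ballP[e /= e0 vB].
have [w Sw vw] := vS e e0; exists w; split=> //.
by apply: vB; rewrite -ball_normE.
Qed.

End closed_subspace_inclusion.

Section compact_approximation.
Context {R : realType} (X Y : completeNormedModType R).
Variables (DX : csubspace (bidual X)) (DY : csubspace (bidual Y)).
Variables (U : bop (dual X) (cs_type DY)) (V : bop (dual Y) (cs_type DX)).
Hypothesis UV : forall f g, val (U f) g = val (V g) f.
Hypothesis Ut : tot_bounded [set U f | f in unit_ball (dual X)].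

Let norm_val (u : cs_type DY) (g : dual Y) : `|val u g| <= `|u| * `|g|.
Proof. by rewrite cs_normE; exact: bop_normP. Qed.

(* By Helly's lemma [phi] is approximated on the totally bounded set [U B] by
   evaluations at some [g], so that [phi \o U] is a norm limit of the [V g]. *)
Lemma functional_comp_mem (phi : dual (cs_type DY)) : ss_set DX (bcomp phi U).
Proof.
apply: cs_approx => e e0.
(* Three errors of [e / 4] will add up: replacing [U f] by a net point under [phi], Helly's lemma at
   that net point, and returning to [U f] under evaluation at [g]. *)
have D0 : 0 < 4 * (`|phi| + 1) by rewrite mulr_gt0// ltr_wpDl.
have [s [sA sB]] := Ut (divr_gt0 e0 D0).
have e40 : 0 < e / 4 by rewrite divr_gt0.
have [] := @helly R (dual Y) (size s) (fun i => val (s`_i)) (fun i => phi s`_i)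
    `|phi| (e / 4) (normr_ge0 _) _ e40.
  (* Helly's condition is the bound of [phi] by its norm: the norm of a combination of net points in
     [cs_type DY] is its norm as a functional on [dual Y]. *)
  move=> a; have -> : \sum_i a i * phi s`_i = phi (\sum_i a i *: s`_i).
    by rewrite bop_sumr; apply: eq_bigr => i _; rewrite bopZr.
  have -> : \sum_i a i *: val s`_i = val (\sum_i a i *: s`_i).
    rewrite cs_val_sum; apply: eq_bigr => i _.
    by rewrite -[a i *: s`_i]addr0 cs_val_linear addr0.
  by rewrite -cs_normE (le_trans (ler_norm _))// bop_normP.
move=> g [gC gs]; exists (val (V g)); first exact: cs_valP.
apply: (@le_lt_trans _ _ (3 * (e / 4))); last by lra.
apply: bop_norm_ball_le => [|f f1]; first by rewrite mulr_ge0// ltW.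
rewrite bopB bcompE -UV.
have [u us Uu] := sB (U f) (imageP U f1).
have us_lt : (index u s < size s)%N by rewrite index_mem.
have := gs (Ordinal us_lt); rewrite /= nth_index// => ug.
have h1 : `|phi (U f) - phi u| <= `|phi| * `|U f - u|.
  by rewrite -bopBr bop_normP.
have h2 : `|val (U f) g - val u g| <= `|U f - u| * `|phi|.
  apply: (@le_trans _ _ (`|U f - u| * `|g|)); last by rewrite ler_wpM2l.
  by rewrite -bopB -cs_valB norm_val.
have h3 : `|U f - u| * `|phi| + `|U f - u| <= e / 4.
  move: Uu; rewrite ltr_pdivlMr// => Uu.
  by have := ltW Uu; lra.
rewrite -(subrKA (phi u)) (le_trans (ler_normD _ _))//.
rewrite -(subrKA (val u g) (phi u)).
have := ler_normD (phi u - val u g) (val u g - val (U f) g).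
rewrite (distrC (val u g)).
have := normr_ge0 (U f - u); lra.
Qed.

Lemma compact_tensor_approximation (e : R) :
  approximation_property (cs_type DY) -> 0 < e ->
  exists s : seq (cs_type DX * cs_type DY), forall f g, `|f| <= 1 -> `|g| <= 1 ->
    `|val (U f) g - \sum_(z <- s) val z.1 f * val z.2 g| <= e.
Proof.
move=> ap e0; have [T [Tf TU]] := ap _ _ (tot_bounded_compact Ut) e0.
have [s Ts] := finite_rank_sum Tf.
exists [seq (cs_mk (functional_comp_mem z.1), z.2) | z <- s] => f g f1 g1.
rewrite big_map /=.
have -> : \sum_(z <- s) bcomp z.1 U f * val z.2 g = val (T (U f)) g.
  rewrite Ts /rank_sum -cs_inclE bop_sumr bop_sum; apply: eq_bigr => z _.
  by rewrite bopZr bopZ.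
have := TU (U f); rewrite distrC => /(_ (subset_closure (imageP U f1))) Ue.
apply: le_trans Ue; rewrite -bopB -cs_valB (le_trans (norm_val _ _))//.
by rewrite ler_piMr.
Qed.

End compact_approximation.

(** * Operators on the injective tensor product *)

Section injective_lift.
Context {R : realType} (X Y W : completeNormedModType R).
Variables (b : X -> Y -> W) (C : R).
Hypothesis bl : forall y, linear (b^~ y).
Hypothesis bC : forall s, `|\sum_(z <- s) b z.1 z.2| <= C * inj_norm (tens_of s).

Definition lift_val (u : tensor X Y) : W :=
  \sum_(z <- sval (cid (tensor_sum u))) b z.1 z.2.

Lemma scale_seq_sum a (s : seq (X * Y)) :
  \sum_(z <- [seq (a *: z.1, z.2) | z <- s]) b z.1 z.2 = a *: \sum_(z <- s) b z.1 z.2.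
Proof.
rewrite big_map scaler_sumr; apply: eq_bigr => z _ /=.
have b0 : b 0 z.2 = 0.
  have /eqP := bl z.2 1 0 0.
  by rewrite !scale1r addr0 -subr_eq subrr eq_sym => /eqP.
by have := bl z.2 a z.1 0; rewrite b0 !addr0.
Qed.

(** The difference of two representations of one tensor represents 0, so [bC] makes its value 0.
    Linearity in the first variable allows a representation to be negated. *)
Lemma lift_valE s : lift_val (tens_of s) = \sum_(z <- s) b z.1 z.2.
Proof.
rewrite /lift_val; case: cid => t /= st; apply/eqP; rewrite -subr_eq0 -normr_le0.
have := bC (t ++ [seq (-1 *: z.1, z.2) | z <- s]).
rewrite big_cat /= scale_seq_sum scaleN1r /tens_of big_cat /= -!/(tens_of _).
rewrite -tens_ofZ scaleN1r /tens_of -st subrr.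
by rewrite [inj_norm 0](sn0 (inj_seminorm X Y)) mulr0.
Qed.

Lemma lift_val_linear : linear lift_val.
Proof.
move=> a u v; have [s us] := tensor_sum u; have [t vt] := tensor_sum v.
have -> : a *: u + v = tens_of ([seq (a *: z.1, z.2) | z <- s] ++ t).
  by rewrite /tens_of big_cat /= -!/(tens_of _) -tens_ofZ us vt.
by rewrite us vt !lift_valE big_cat /= scale_seq_sum.
Qed.

Lemma lift_val_bounded u : `|lift_val u| <= C * inj_seminorm X Y u.
Proof. by have [s ->] := tensor_sum u; rewrite lift_valE; exact: bC. Qed.

Definition inj_lift : bop (injective_tensor X Y) W :=
  extension lift_val_linear lift_val_bounded.

Lemma inj_lift_sum s :
  inj_lift (to_completion _ (tens_of s)) = \sum_(z <- s) b z.1 z.2.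
Proof. by rewrite /inj_lift extensionE lift_valE. Qed.

Lemma inj_liftE x y : inj_lift (inj_tens x y) = b x y.
Proof.
have -> : inj_tens x y = to_completion _ (tens_of [:: (x, y)]) by rewrite /tens_of big_seq1.
by rewrite inj_lift_sum big_seq1.
Qed.

Lemma inj_lift_norm w : `|inj_lift w| <= C * `|w|.
Proof. exact: (ext_bounded lift_val_linear lift_val_bounded). Qed.

End injective_lift.

Section injective_tensor_operators.
Context {R : realType}.
Implicit Types X Y W : completeNormedModType R.

Lemma inj_tensDl X Y a (x x' : X) (y : Y) :
  inj_tens (a *: x + x') y = a *: inj_tens x y + inj_tens x' y.
Proof. by rewrite /inj_tens tensDl to_completion_linear. Qed.

Lemma inj_tensDr X Y a (x : X) (y y' : Y) :
  inj_tens x (a *: y + y') = a *: inj_tens x y + inj_tens x y'.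
Proof. by rewrite /inj_tens tensDr to_completion_linear. Qed.

Lemma inj_norm_le_proj X Y (u : tensor X Y) : inj_norm u <= proj_norm u.
Proof.
apply: proj_norm_ge => s ->; apply: inj_norm_le => f g f1 g1.
by rewrite (le_trans (fprod_cost f g s))// ler_piMl ?cost_ge0// mulr_ile1.
Qed.

Lemma norm_inj_tens X Y (x : X) (y : Y) : `|inj_tens x y| <= `|x| * `|y|.
Proof.
rewrite norm_to_completion /= (le_trans (inj_norm_le_proj _))//.
by have := proj_norm_le [:: (x, y)]; rewrite /tens_of /cost !big_seq1.
Qed.

Lemma to_completion_tens_of X Y (s : seq (X * Y)) :
  to_completion (inj_seminorm X Y) (tens_of s) = \sum_(z <- s) inj_tens z.1 z.2.
Proof. by rewrite /tens_of linear_sum. Qed.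

Lemma inj_bop_eq X Y W (T S : bop (injective_tensor X Y) W) :
  (forall x y, T (inj_tens x y) = S (inj_tens x y)) -> T = S.
Proof.
move=> TS; apply: completion_bop_eq => u; have [s ->] := tensor_sum u.
rewrite -/(tens_of s) to_completion_tens_of !bop_sumr.
by apply: eq_bigr => z _.
Qed.

Lemma tens_of_fprod X Y (s : seq (X * Y)) (f : dual X) (g : dual Y) :
  tens_of s (Defs.fprod f g) = \sum_(z <- s) f z.1 * g z.2.
Proof. by rewrite /tens_of tensor_sumE. Qed.

Lemma sum_fprod_bound X Y (s : seq (X * Y)) (f : dual X) (g : dual Y) :
  `|\sum_(z <- s) f z.1 * g z.2| <= inj_norm (tens_of s) * (`|f| * `|g|).
Proof. by rewrite -tens_of_fprod inj_norm_fprod. Qed.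

Section tensor_map.
Variables (X X' Y Y' : completeNormedModType R) (A : bop X X') (B : bop Y Y').

Lemma tensor_map_lin y : linear (fun x => inj_tens (A x) (B y)).
Proof. by move=> a u v; rewrite bopDr bopZr inj_tensDl. Qed.

(** The metric mapping property: testing against [f] and [g] amounts to testing the original tensor
    against [bcomp f A] and [bcomp g B]. *)
Lemma tensor_map_bound (s : seq (X * Y)) :
  `|\sum_(z <- s) inj_tens (A z.1) (B z.2)| <= (`|A| * `|B|) * inj_norm (tens_of s).
Proof.
have -> : \sum_(z <- s) inj_tens (A z.1) (B z.2) =
    to_completion (inj_seminorm X' Y') (tens_of [seq (A z.1, B z.2) | z <- s]).
  by rewrite to_completion_tens_of big_map.
rewrite norm_to_completion; apply: inj_norm_le => f g f1 g1.
rewrite tens_of_fprod big_map mulrC.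
apply: (le_trans (sum_fprod_bound s (bcomp f A) (bcomp g B))).
rewrite ler_wpM2l ?inj_norm_ge0// ler_pM//.
  by rewrite (le_trans (bcomp_norm _ _))// ler_piMl.
by rewrite (le_trans (bcomp_norm _ _))// ler_piMl.
Qed.

Definition tensor_map : bop (injective_tensor X Y) (injective_tensor X' Y') :=
  inj_lift tensor_map_lin tensor_map_bound.

Lemma tensor_mapE x y : tensor_map (inj_tens x y) = inj_tens (A x) (B y).
Proof. exact: inj_liftE. Qed.

End tensor_map.

Section slices.
Variables (X Y : completeNormedModType R).

Section left.
Variable f : dual X.

Lemma slice_left_lin (y : Y) : linear (fun x : X => (f x : R) *: y).
Proof. by move=> a u v; rewrite bopDr bopZr scalerDl scalerA. Qed.

Lemma slice_left_bound (s : seq (X * Y)) :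
  `|\sum_(z <- s) (f z.1 : R) *: z.2| <= `|f| * inj_norm (tens_of s).
Proof.
apply: norm_le_dual => g g1.
have -> : g (\sum_(z <- s) (f z.1 : R) *: z.2) = \sum_(z <- s) f z.1 * g z.2.
  by rewrite bop_sumr; apply: eq_bigr => z _; rewrite bopZr.
rewrite (le_trans (sum_fprod_bound s f g))// mulrC ler_wpM2r ?inj_norm_ge0//.
by rewrite ler_piMr.
Qed.

(** The slice map f (x) id. Its biadjoint carries Delta (X (x) Y) into Delta Y, which is how an
    element of the former becomes an operator from [dual X] to Delta Y. *)
Definition slice_left : bop (injective_tensor X Y) Y :=
  inj_lift slice_left_lin slice_left_bound.

Lemma slice_leftE x y : slice_left (inj_tens x y) = (f x : R) *: y.
Proof. exact: inj_liftE. Qed.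

End left.

Section right.
Variable g : dual Y.

Lemma slice_right_lin (y : Y) : linear (fun x : X => (g y : R) *: x).
Proof. by move=> a u v; rewrite scalerDr !scalerA mulrC. Qed.

Lemma slice_right_bound (s : seq (X * Y)) :
  `|\sum_(z <- s) (g z.2 : R) *: z.1| <= `|g| * inj_norm (tens_of s).
Proof.
apply: norm_le_dual => f f1.
have -> : f (\sum_(z <- s) (g z.2 : R) *: z.1) = \sum_(z <- s) f z.1 * g z.2.
  by rewrite bop_sumr; apply: eq_bigr => z _; rewrite bopZr [RHS]mulrC.
rewrite (le_trans (sum_fprod_bound s f g))// mulrC ler_wpM2r ?inj_norm_ge0//.
by rewrite ler_piMl.
Qed.

Definition slice_right : bop (injective_tensor X Y) X :=
  inj_lift slice_right_lin slice_right_bound.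

Lemma slice_rightE x y : slice_right (inj_tens x y) = (g y : R) *: x.
Proof. exact: inj_liftE. Qed.

End right.

Definition ftens (f : dual X) (g : dual Y) : dual (injective_tensor X Y) :=
  canonical_operator X Y (proj_tens f g).

Lemma ftensE f g x y : ftens f g (inj_tens x y) = f x * g y.
Proof. exact: canonical_operatorE. Qed.

Lemma ftens_slice_left f g : ftens f g = bcomp g (slice_left f).
Proof.
by apply: inj_bop_eq => x y; rewrite ftensE bcompE slice_leftE bopZr.
Qed.

Lemma ftens_slice_right f g : ftens f g = bcomp f (slice_right g).
Proof.
by apply: inj_bop_eq => x y; rewrite ftensE bcompE slice_rightE bopZr mulrC.
Qed.

Lemma norm_ftens f g : `|ftens f g| <= `|f| * `|g|.
Proof.
rewrite ftens_slice_left (le_trans (bcomp_norm _ _))// mulrC ler_wpM2r//.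
by apply: bop_norm_le => // w; exact: inj_lift_norm.
Qed.

Lemma proj_to_inj_bound (u : tensor X Y) :
  `|to_completion (inj_seminorm X Y) u| <= 1 * proj_seminorm X Y u.
Proof. by rewrite mul1r norm_to_completion; exact: inj_norm_le_proj. Qed.

Definition proj_to_inj : bop (projective_tensor X Y) (injective_tensor X Y) :=
  extension (to_completion_linear (inj_seminorm X Y)) proj_to_inj_bound.

Lemma proj_to_injE x y : proj_to_inj (proj_tens x y) = inj_tens x y.
Proof. exact: extensionE. Qed.

(** Passing through [proj_to_inj] presents functionals on the injective product as functionals on
    the projective one, the setting of [ti_operators]. *)
Definition form_operator (phi : dual (injective_tensor X Y)) : bop X (dual Y) :=
  operator_of (bcomp phi proj_to_inj).

Lemma form_operatorE phi x y : form_operator phi x y = phi (inj_tens x y).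
Proof. by rewrite -proj_to_injE. Qed.

Lemma functional_of_form phi :
  functional_of (form_operator phi) = bcomp phi proj_to_inj.
Proof. exact: operator_ofK. Qed.

Section left_tensor.
Variable x : X.

Lemma left_tens_linear : linear (fun y : Y => inj_tens x y).
Proof. by move=> a y z; rewrite inj_tensDr. Qed.

Definition left_tens : bop Y (injective_tensor X Y) :=
  mkbop left_tens_linear (@norm_inj_tens X Y x).

End left_tensor.
End slices.
End injective_tensor_operators.

(** * Biadjoints and tensors of bidual elements *)

Section closures.
Context {R : realType}.
Implicit Types V W : completeNormedModType R.

Lemma closure_normP V (A : set V) (v : V) :
  closure A v <-> forall e, 0 < e -> exists2 a, A a & `|v - a| < e.
Proof.
split=> [vA e e0|vA B /nbhs_ballP[e /= e0 vB]].
  have [a [Aa va]] := vA _ (nbhsx_ballx v e e0); exists a => //.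
  by move: va; rewrite -ball_normE.
have [a Aa va] := vA e e0; exists a; split=> //.
by apply: vB; rewrite -ball_normE.
Qed.

Lemma closure_bop V W (L : bop V W) (A : set V) (B : set W) :
  (forall v, A v -> closure B (L v)) -> forall v, closure A v -> closure B (L v).
Proof.
move=> AB v /closure_normP vA; apply/closure_normP => e e0.
have e20 : 0 < e / 2 by rewrite divr_gt0.
have L0 : 0 < `|L| + 1 by rewrite ltr_wpDl.
have [a Aa va] := vA _ (divr_gt0 e20 L0).
have [b Bb ab] := (closure_normP _ _).1 (AB a Aa) _ e20.
exists b => //; rewrite -(subrKA (L a)) (splitr e) (le_lt_trans (ler_normD _ _))// ltrD//.
rewrite -bopBr (le_lt_trans (bop_normP _ _))//.
move: va; rewrite ltr_pdivlMr// => va; apply: le_lt_trans va.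
by rewrite mulrC ler_wpM2l// lerDl.
Qed.

Lemma norm_adherent V W (h : bop V W) (e : R) : 0 < e ->
  exists x, `|x| <= 1 /\ `|h| <= `|h x| + e.
Proof.
move=> e0; apply: contrapT => /forallNP nx.
have hx x : `|x| <= 1 -> `|h x| <= `|h| - e.
  by move=> x1; rewrite leNgt; apply/negP => hx; apply: (nx x); split=> //; lra.
have h0 : 0 <= `|h| - e by rewrite (le_trans _ (hx 0 _))// normr0.
by have := bop_norm_ball_le h0 hx; lra.
Qed.

Lemma adjoint_linear V W (T : bop V W) : linear (fun phi : dual W => bcomp phi T : dual V).
Proof. by move=> a f g; exact/bopP. Qed.

Lemma adjoint_bounded V W (T : bop V W) (phi : dual W) :
  `|bcomp phi T : dual V| <= `|T| * `|phi|.
Proof. by rewrite mulrC; exact: bcomp_norm. Qed.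

Definition adjoint V W (T : bop V W) : bop (dual W) (dual V) :=
  mkbop (adjoint_linear T) (adjoint_bounded T).

Definition biadjoint V W (T : bop V W) : bop (bidual V) (bidual W) := adjoint (adjoint T).

Lemma biadjointE V W (T : bop V W) (z : bidual V) (phi : dual W) :
  biadjoint T z phi = z (bcomp phi T).
Proof. by []. Qed.

End closures.

Section tensors_of_bidual_elements.
Context {R : realType} (X Y : completeNormedModType R).
Local Notation Z := (injective_tensor X Y).

Lemma form_operator_linear : linear (@form_operator R X Y).
Proof.
move=> a phi psi; apply/bopP => x; apply/bopP => y.
by rewrite !bopD !bopZ !form_operatorE.
Qed.

Lemma form_operator_norm (phi : dual Z) x : `|form_operator phi x| <= `|phi| * `|x|.
Proof.
apply: bop_norm_le => [|y]; first by rewrite mulr_ge0.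
rewrite form_operatorE (le_trans (bop_normP _ _))// -mulrA ler_wpM2l//.
exact: norm_inj_tens.
Qed.

Section form_adjoint.
Variable y : bidual Y.

Lemma form_adjoint_linear :
  linear (fun phi : dual Z => bcomp y (form_operator phi) : dual X).
Proof.
move=> a phi psi; apply/bopP => x.
by rewrite form_operator_linear bcompE !bopD !bopZ bopDr bopZr.
Qed.

Lemma form_adjoint_bounded (phi : dual Z) :
  `|bcomp y (form_operator phi) : dual X| <= `|y| * `|phi|.
Proof.
apply: bop_norm_le => [|x]; first by rewrite mulr_ge0.
rewrite bcompE (le_trans (bop_normP y _))// -mulrA ler_wpM2l//.
exact: form_operator_norm.
Qed.

Definition form_adjoint : bop (dual Z) (dual X) :=
  mkbop form_adjoint_linear form_adjoint_bounded.

End form_adjoint.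

(** The iterated extension of a bilinear form to the biduals, second variable first: this order
    produces the functionals y^{**} \o T to which [ti_operators] applies. *)
Definition bidual_tens (x : bidual X) (y : bidual Y) : bidual Z :=
  bcomp x (form_adjoint y).

Lemma bidual_tensE x y phi : bidual_tens x y phi = x (bcomp y (form_operator phi)).
Proof. by []. Qed.

Lemma bidual_tens_norm x y : `|bidual_tens x y| <= `|x| * `|y|.
Proof.
rewrite (le_trans (bcomp_norm _ _))// ler_wpM2l//.
by apply: bop_norm_le => // phi; exact: form_adjoint_bounded.
Qed.

Lemma bidual_tens_linearl (y : bidual Y) : linear (fun x : bidual X => bidual_tens x y).
Proof. by move=> a x x'; apply/bopP => phi. Qed.

Lemma bidual_tens_linearr (x : bidual X) : linear (bidual_tens x).
Proof.
move=> a y y'; apply/bopP => phi; rewrite bopD bopZ !bidual_tensE -bopZr -bopDr.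
by congr (bop_fun x _); apply/bopP.
Qed.

Lemma bidual_tens_ftens x y f g : bidual_tens x y (ftens f g) = x f * y g.
Proof.
rewrite bidual_tensE.
have -> : bcomp y (form_operator (ftens f g)) = (y g : R) *: f :> dual X.
  apply/bopP => u; rewrite bcompE bopZ.
  have -> : form_operator (ftens f g) u = (f u : R) *: g :> dual Y.
    by apply/bopP => v; rewrite form_operatorE ftensE bopZ.
  by rewrite bopZr; exact: mulrC.
by rewrite bopZr; exact: mulrC.
Qed.

Lemma bidual_tens_canonical (x : X) (y : Y) :
  bidual_tens (canonical_embedding X x) (canonical_embedding Y y) =
  canonical_embedding Z (inj_tens x y).
Proof. by apply/bopP => phi; exact: form_operatorE. Qed.

Definition bidual_tens_l (y : bidual Y) : bop (bidual X) (bidual Z).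
Proof.
apply: (@mkbop R (bidual X) (bidual Z) _ (bidual_tens_linearl y) `|y|) => x.
by rewrite mulrC; exact: bidual_tens_norm.
Defined.

Definition bidual_tens_r (x : bidual X) : bop (bidual Y) (bidual Z) :=
  mkbop (bidual_tens_linearr x) (bidual_tens_norm x).

End tensors_of_bidual_elements.

(** * Stability and weak-star continuity of the assignment *)

Section testing_ideals.
Context {R : realType} (I : testing_ideal R).
Implicit Types V W X Y : completeNormedModType R.

(** If [z] agrees with [v] on the image of [A] under the adjoint of [T], then its biadjoint image
    agrees with [T v] on [A]. *)
Lemma assignment0_biadjoint V W (T : bop V W) z :
  assignment0 I z -> assignment0 I (biadjoint T z).
Proof.
move=> zI A IA; have [v zv] := zI _ (ti_adjoint T IA).
by exists (T v) => f Af; rewrite biadjointE zv//; exists f.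
Qed.

Lemma assignment_biadjoint V W (T : bop V W) z :
  assignment_set I z -> assignment_set I (biadjoint T z).
Proof.
apply: closure_bop => v /(assignment0_biadjoint T) vI.
exact: subset_closure.
Qed.

(** On [A] the factor [x] is first replaced by a point [u] of [X], because the functionals to which
    [x] is applied form a set of the ideal. What remains is the biadjoint image of [y] under
    [left_tens Y u], already known to lie in [assignment0]. *)
Lemma assignment0_bidual_tens X Y x y : assignment0 I x -> assignment0 I y ->
  assignment0 I (@bidual_tens R X Y x y).
Proof.
move=> xI yI A IA.
have [|u xu] := xI [set bcomp y (form_operator phi) | phi in A].
  rewrite (_ : [set _ | _ in A] =
      [set (bcomp y T : dual X) | T in (@form_operator R X Y) @` A]); last first.
    by rewrite image_comp.
  apply: ti_operators; last exact: subset_closure.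
  rewrite image_comp (_ : _ @` A = [set (bcomp phi (proj_to_inj X Y) : dual _) | phi in A]).
    exact: ti_adjoint.
  by apply: eq_imagel => phi _; exact: functional_of_form.
have [w yw] := assignment0_biadjoint (left_tens Y u) yI IA.
exists w => phi Aphi; rewrite bidual_tensE xu; last by exists phi.
rewrite bcompE -yw// biadjointE; congr (bop_fun y _).
by apply/bopP => v; rewrite form_operatorE.
Qed.

Lemma assignment_bidual_tens X Y x y : assignment_set I x -> assignment_set I y ->
  assignment_set I (@bidual_tens R X Y x y).
Proof.
move=> xI yI; apply: (closure_bop (L := bidual_tens_l X y)) xI => u uI.
apply: (closure_bop (L := bidual_tens_r Y u)) yI => v vI.
apply: subset_closure; exact: assignment0_bidual_tens.
Qed.

(** A nearby [z'] in [assignment0] coincides with a point [v] on the countable set formed by the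
    sequence and its limit; there weak-star convergence is convergence at [v]. Boundedness makes the
    error of [z'] uniform. *)
Lemma assignment_weakstar V (z : bidual V) (s : nat -> dual V) (f : dual V) (C : R) :
  assignment_set I z -> (forall n, `|s n| <= C) -> weakstar_cvg s f ->
  forall e, 0 < e -> exists N, forall n, (N <= n)%N -> `|z (s n) - z f| < e.
Proof.
move=> /closure_normP zI sC sf e e0.
have C0 : 0 <= C by exact: le_trans (sC 0%N).
have e30 : 0 < e / 3 by rewrite divr_gt0.
have D0 : 0 < C + `|f| + 1 by rewrite ltr_wpDl// addr_ge0.
have [z' z'I zz'] := zI _ (divr_gt0 e30 D0).
have near (g : dual V) : `|g| <= C + `|f| -> `|z g - z' g| < e / 3.
  move=> gC; rewrite -bopB (le_lt_trans (bop_normP (z - z') g))//.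
  move: zz'; rewrite ltr_pdivlMr//; apply: le_lt_trans.
  by rewrite ler_wpM2l// (le_trans gC)// lerDl.
have [|v z'v] := z'I (range s `|` [set f]).
  apply: ti_setU; apply: ti_countable; last exact: finite_set_countable.
  exact: (sub_countable (card_image_le _ _)).
have /seq_limitP/(_ _ e30)[N HN] := sf v.
exists N => n /HN sv.
have h1 : `|z (s n) - z' (s n)| < e / 3 by apply: near; rewrite (le_trans (sC n))// lerDl.
have h2 : `|z f - z' f| < e / 3 by apply: near; rewrite lerDr.
have h3 : `|z' (s n) - z' f| < e / 3.
  by rewrite (z'v (s n)) ?(z'v f)//; [right|left; exists n].
have := ler_distD (z' (s n)) (z (s n)) (z f).
have := ler_distD (z' f) (z' (s n)) (z f).
by rewrite [`|z' f - z f|]distrC; lra.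
Qed.

End testing_ideals.

Section weakstar_sequences.
Context {R : realType} (X Y : completeNormedModType R).
Local Notation Z := (injective_tensor X Y).

(** Boundedness reduces the claim to the dense set of finite sums of elementary tensors. *)
Lemma weakstar_cvg_tens (s : nat -> dual Z) (C : R) : (forall n, `|s n| <= C) ->
  (forall x y e, 0 < e -> exists N, forall n, (N <= n)%N -> `|s n (inj_tens x y)| < e) ->
  weakstar_cvg s 0.
Proof.
move=> sC s0 w; have C0 : 0 <= C by exact: le_trans (sC 0%N).
apply/seq_limitP => e e0; have e20 : 0 < e / 2 by rewrite divr_gt0.
have D0 : 0 < C + 1 by rewrite ltr_wpDl.
have [u uw] := to_completion_dense w (divr_gt0 e20 D0).
have su d : 0 < d -> exists N, forall n, (N <= n)%N -> `|s n (to_completion _ u)| < d.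
  have [t ->] := tensor_sum u; rewrite -/(tens_of t) to_completion_tens_of.
  elim: t d => [|z t IH] d d0.
    by exists 0%N => n _; rewrite big_nil bop0r normr0.
  have d20 : 0 < d / 2 by rewrite divr_gt0.
  have [N HN] := s0 z.1 z.2 _ d20; have [M HM] := IH _ d20.
  exists (maxn N M) => n; rewrite geq_max => /andP[/HN zn /HM tn].
  by rewrite big_cons bopDr (splitr d) (le_lt_trans (ler_normD _ _))// ltrD.
have [N HN] := su _ e20.
exists N => n /HN sn.
rewrite -[w](subKr (to_completion _ u)) bopBr subr0 (le_lt_trans (ler_normB _ _))//.
rewrite (splitr e) ltrD//.
rewrite (le_lt_trans (bop_normP (s n) _))//; move: uw; rewrite ltr_pdivlMr//.
apply: le_lt_trans; rewrite mulrC ler_wpM2l// (le_trans (sC n))// lerDl//.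
Qed.

Lemma weakstar_cvg_mul (V W : completeNormedModType R) (s : nat -> dual V)
    (g : nat -> dual W) v w :
  weakstar_cvg s 0 -> (forall n, `|g n| <= 1) ->
  forall e, 0 < e -> exists N, forall n, (N <= n)%N -> `|s n v * g n w| < e.
Proof.
move=> s0 g1 e e0.
have D0 : 0 < `|w| + 1 by rewrite ltr_wpDl.
have /seq_limitP/(_ _ (divr_gt0 e0 D0))[N HN] := s0 v.
exists N => n /HN; rewrite !subr0 ltr_pdivlMr//; apply: le_lt_trans.
rewrite normrM ler_wpM2l// (le_trans (bop_norm_ball w (g1 n)))// lerDl//.
Qed.

End weakstar_sequences.

(** * Norms and slices in the assignment of a tensor product *)

Section assignment_of_injective_tensor.
Context {R : realType} (I : testing_ideal R) (X Y : completeNormedModType R).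
Local Notation Z := (injective_tensor X Y).

Lemma ftens_linearl (g : dual Y) : linear (fun f : dual X => ftens f g).
Proof.
move=> a f f'; apply: inj_bop_eq => x y.
by rewrite bopD bopZ !ftensE bopD bopZ mulrDl -mulrA.
Qed.

Lemma ftens_linearr (f : dual X) : linear (fun g : dual Y => ftens f g).
Proof.
move=> a g g'; apply: inj_bop_eq => x y.
by rewrite bopD bopZ !ftensE bopD bopZ mulrDr mulrCA.
Qed.

Lemma ftensZ a b (f : dual X) (g : dual Y) :
  ftens (a *: f) (b *: g) = (a * b) *: ftens f g.
Proof.
apply: inj_bop_eq => x y; rewrite bopZ !ftensE !bopZ.
by rewrite -[a *: _]/(a * _) -[b *: _]/(b * _) -[_ *: _]/(_ * _) mulrACA.
Qed.

Lemma ftens_bound (z : bidual Z) (c : R) : 0 <= c ->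
  (forall f g, `|f| <= 1 -> `|g| <= 1 -> `|z (ftens f g)| <= c) ->
  forall f g, `|z (ftens f g)| <= c * (`|f| * `|g|).
Proof.
move=> c0 zc f g.
have [f0|f0] := eqVneq f 0.
  have -> : ftens f g = 0 by apply: inj_bop_eq => x y; rewrite ftensE f0 mul0r.
  by rewrite bop0r normr0 mulr_ge0// mulr_ge0.
have [g0|g0] := eqVneq g 0.
  have -> : ftens f g = 0 by apply: inj_bop_eq => x y; rewrite ftensE g0 mulr0.
  by rewrite bop0r normr0 mulr_ge0// mulr_ge0.
have nf : `|f| != 0 by rewrite normr_eq0.
have ng : `|g| != 0 by rewrite normr_eq0.
have -> : ftens f g = (`|f| * `|g|) *: ftens (`|f|^-1 *: f) (`|g|^-1 *: g).
  by rewrite -ftensZ !scalerA !mulfV// !scale1r.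
rewrite bopZr normrZ ger0_norm ?mulr_ge0// mulrC ler_wpM2r ?mulr_ge0//.
by apply: zc; rewrite normrZ normfV normr_id mulVf.
Qed.

Hypothesis ball_dense : weakstar_seq_dense
  [set canonical_operator X Y u | u in unit_ball (projective_tensor (dual X) (dual Y))]
  (unit_ball (dual Z)).

(** The projective norm is an infimum of costs, so the bound on elementary functionals passes to
    [canonical_operator X Y u] as [c * |u|], and by weak-star sequential continuity to the whole
    dual ball. *)
Lemma assignment_norm_le (z : bidual Z) (c : R) : 0 <= c -> assignment_set I z ->
  (forall f g, `|f| <= 1 -> `|g| <= 1 -> `|z (ftens f g)| <= c) -> `|z| <= c.
Proof.
move=> c0 zI /(ftens_bound c0) zc.
apply: bop_norm_ball_le => // phi /ball_dense[s [sG sphi]].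
have zG u : `|z (canonical_operator X Y u)| <= c * `|u|.
  apply: (completion_norm_le (T := bcomp z (canonical_operator X Y)) c0) => t.
  (* The infimum over representations is compared after division by [c], so [c = 0] is treated
     apart. *)
  have [c00|c00] := eqVneq c 0.
    have [r ->] := tensor_sum t.
    rewrite linear_sum bop_sumr big1 ?normr0 ?c00 ?mul0r// => w _.
    apply/eqP; rewrite -normr_le0; apply: (le_trans (zc w.1 w.2)).
    by rewrite c00 mul0r.
  have cp : 0 < c by rewrite lt_def c00.
  rewrite -ler_pdivrMl//; apply: proj_norm_ge => r ->; rewrite ler_pdivrMl//.
  rewrite /tens_of linear_sum bop_sumr (le_trans (ler_norm_sum _ _ _))//.
  by rewrite /cost mulr_sumr ler_sum// => w _; exact: zc.
have sC n : `|s n| <= `|canonical_operator X Y|.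
  have [u u1 <-] := sG n; rewrite (le_trans (bop_normP _ _))//.
  by rewrite ler_piMr.
apply/ler_addgt0Pr => e e0.
have [N /(_ N (leqnn N))] := assignment_weakstar zI sC sphi e0.
have [u u1 us] := sG N; rewrite -us distrC => zs.
have := ler_distD (z (canonical_operator X Y u)) (z phi) 0.
rewrite !subr0; have := zG u; have : c * `|u| <= c by rewrite ler_piMr.
by move: zs; lra.
Qed.

Section slices_of_assignment.
Variable z : assignment I Z.

Lemma left_mem (f : dual X) :
  ss_set (assignment_subspace I Y) (biadjoint (slice_left Y f) (val z)).
Proof. exact: assignment_biadjoint (cs_valP z). Qed.

Definition left_val f : assignment I Y := cs_mk (@left_mem f).

Lemma left_valE f g : val (left_val f) g = val z (ftens f g).
Proof. by rewrite ftens_slice_left. Qed.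

Lemma left_val_linear : linear left_val.
Proof.
move=> a f f'; apply: cs_val_eq; apply/bopP => g.
rewrite cs_val_linear bopD bopZ !left_valE.
by rewrite ftens_linearl bopDr bopZr.
Qed.

Lemma left_val_bounded f : `|left_val f| <= `|val z| * `|f|.
Proof.
rewrite cs_normE; apply: bop_norm_le => [|g]; first by rewrite mulr_ge0.
rewrite left_valE (le_trans (bop_normP _ _))// -mulrA ler_wpM2l//.
exact: norm_ftens.
Qed.

Definition left_operator : bop (dual X) (assignment I Y) :=
  mkbop left_val_linear left_val_bounded.

Lemma left_operatorE f g : val (left_operator f) g = val z (ftens f g).
Proof. exact: left_valE. Qed.

Lemma right_mem (g : dual Y) :
  ss_set (assignment_subspace I X) (biadjoint (slice_right X g) (val z)).
Proof. exact: assignment_biadjoint (cs_valP z). Qed.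

Definition right_val g : assignment I X := cs_mk (@right_mem g).

Lemma right_valE g f : val (right_val g) f = val z (ftens f g).
Proof. by rewrite ftens_slice_right. Qed.

Lemma right_val_linear : linear right_val.
Proof.
move=> a g g'; apply: cs_val_eq; apply/bopP => f.
rewrite cs_val_linear bopD bopZ !right_valE.
by rewrite ftens_linearr bopDr bopZr.
Qed.

Lemma right_val_bounded g : `|right_val g| <= `|val z| * `|g|.
Proof.
rewrite cs_normE; apply: bop_norm_le => [|f]; first by rewrite mulr_ge0.
rewrite right_valE (le_trans (bop_normP _ _))// -mulrA ler_wpM2l//.
by rewrite mulrC; exact: norm_ftens.
Qed.

Definition right_operator : bop (dual Y) (assignment I X) :=
  mkbop right_val_linear right_val_bounded.

Lemma right_operatorE g f : val (right_operator g) f = val z (ftens f g).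
Proof. exact: right_valE. Qed.

End slices_of_assignment.
End assignment_of_injective_tensor.

(** * Compactness of the slice operators *)

Section compactness.
Context {R : realType} (I : testing_ideal R) (V W Z : completeNormedModType R).
Variables (DW : csubspace (bidual W)) (U : bop (dual V) (cs_type DW)).
Variables (z : bidual Z) (h : dual V -> dual W -> dual Z).
Hypothesis zI : assignment_set I z.
Hypothesis Uh : forall f g, val (U f) g = z (h f g).
Hypothesis hn : forall f g, `|h f g| <= `|f| * `|g|.
Hypothesis h0 : forall s g, (exists C : R, forall n, `|s n| <= C) -> weakstar_cvg s 0 ->
  (forall n, `|g n| <= 1) -> weakstar_cvg (fun n => h (s n) (g n)) 0.

(* Choosing [g n] almost norming [U (s n)], the functionals [h (s n) (g n)] are bounded
   and weak-star null, and [z] is weak-star sequentially continuous on bounded sets. *)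
Lemma weakstar_null_image (s : nat -> dual V) (C : R) : (forall n, `|s n| <= C) ->
  weakstar_cvg s 0 -> forall e, 0 < e -> exists N, forall n, (N <= n)%N -> `|U (s n)| < e.
Proof.
move=> sC s0 e e0; have e20 : 0 < e / 2 by rewrite divr_gt0.
have C0 : 0 <= C by exact: le_trans (sC 0%N).
have /choice[g gP] := fun n => norm_adherent (val (U (s n))) e20.
have g1 n : `|g n| <= 1 by have [] := gP n.
have hC n : `|h (s n) (g n)| <= C.
  by rewrite (le_trans (hn _ _))// -[C]mulr1 ler_pM.
have [N HN] := assignment_weakstar zI hC (h0 (ex_intro _ C sC) s0 g1) e20.
exists N => n /HN; rewrite bop0r subr0 -Uh => zn.
rewrite cs_normE; have [_] := gP n; move: zn; lra.
Qed.

(** After subtraction of a weak-star limit [l], a subsequence is weak-star null and its image is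
    norm null. The form [h] stands for [ftens] with its arguments in either order, so that both
    slice operators are covered. *)
Lemma image_tot_bounded : weakstar_seq_compact (unit_ball (dual V)) ->
  tot_bounded [set U f | f in unit_ball (dual V)].
Proof.
move=> Vc; apply: seq_tot_bounded => u uB.
have /choice[f fP] : forall n, exists f : dual V, `|f| <= 1 /\ U f = u n.
  by move=> n; have [f f1 fu] := uB n; exists f.
have [k [l [kmono fl]]] := Vc f (fun n => (fP n).1).
exists k; split=> //.
pose s n := f (k n) - l.
(* The bound [1 + |l|] avoids having to place [l] in the ball. *)
have sC n : `|s n| <= 1 + `|l|.
  by rewrite (le_trans (ler_normB _ _))// lerD2r; have [] := fP (k n).
have s0 : weakstar_cvg s 0.
  move=> v; have -> : (0 : dual V) v = l v - l v by rewrite subrr.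
  by apply: cvgB; [exact: fl|exact: cvg_cst].
move=> e e0; have e20 : 0 < e / 2 by rewrite divr_gt0.
have [N HN] := weakstar_null_image sC s0 e20.
exists N => m n Nm Nn /=; rewrite -(fP (k m)).2 -(fP (k n)).2.
have sE i : U (f (k i)) = U (s i) + U l by rewrite bopBr subrK.
rewrite !sE opprD addrACA subrr addr0 (splitr e) (le_lt_trans (ler_normB _ _))// ltrD//; exact: HN.
Qed.

End compactness.

Section canonical_embedding_in_assignment.
Context {R : realType} (I : testing_ideal R) (X : completeNormedModType R).

Lemma canonical_embedding_mem (x : X) :
  ss_set (assignment_subspace I X) (canonical_embedding X x).
Proof. by apply: subset_closure => A _; exists x. Qed.

Definition canon_val (x : X) : assignment I X := cs_mk (@canonical_embedding_mem x).

Lemma canon_val_linear : linear canon_val.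
Proof. by move=> a x y; apply: cs_val_eq; rewrite cs_val_linear; exact: evalb_is_linear. Qed.

Lemma canon_val_bounded x : `|canon_val x| <= 1 * `|x|.
Proof. by rewrite mul1r cs_normE norm_canonical_embedding. Qed.

Definition canon : bop X (assignment I X) := mkbop canon_val_linear canon_val_bounded.

Lemma canonE x : val (canon x) = canonical_embedding X x. Proof. by []. Qed.

Lemma norm_canon x : `|canon x| = `|x|.
Proof. by rewrite cs_normE canonE norm_canonical_embedding. Qed.

Lemma canonical_imageP d : canonical_image I X d <-> exists x, d = canon x.
Proof.
split=> [[x dx]|[x ->]]; last by exists x.
by exists x; exact: cs_val_eq.
Qed.

End canonical_embedding_in_assignment.

Lemma assignment_valP (R : realType) (I : testing_ideal R) (V : completeNormedModType R)
  (d : assignment I V) : assignment_set I (val d).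
Proof. exact: (cs_valP (S := assignment_subspace I V) d). Qed.

(** * The isometry between the tensor product of assignments and the assignment of the tensor
    product *)

Section assignment_tensor.
Context {R : realType} (I : testing_ideal R) (X Y : completeNormedModType R).
Local Notation Z := (injective_tensor X Y).
Local Notation DX := (assignment I X).
Local Notation DY := (assignment I Y).
Local Notation DZ := (assignment I Z).

Definition assignment_tens (x : DX) (y : DY) : DZ :=
  @cs_mk _ _ (assignment_subspace I Z) (bidual_tens (val x) (val y))
    (assignment_bidual_tens (cs_valP x) (cs_valP y)).

Lemma assignment_tens_linear y : linear (assignment_tens^~ y).
Proof.
move=> a x x'; apply: cs_val_eq; rewrite cs_val_linear.
exact: (bidual_tens_linearl (val y) a (val x) (val x')).
Qed.

Lemma assignment_tens_ftens x y f g :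
  val (assignment_tens x y) (ftens f g) = val x f * val y g.
Proof. exact: bidual_tens_ftens. Qed.

Lemma assignment_tens_sum (s : seq (DX * DY)) f g :
  val (\sum_(z <- s) assignment_tens z.1 z.2) (ftens f g) =
  \sum_(z <- s) val z.1 f * val z.2 g.
Proof.
rewrite -cs_inclE bop_sumr bop_sum; apply: eq_bigr => z _.
exact: assignment_tens_ftens.
Qed.

Definition assignment_eval (V : completeNormedModType R) (f : dual V) :
  dual (assignment I V) := bcomp (evalb f) (cs_incl (assignment_subspace I V)).

Lemma assignment_evalE (V : completeNormedModType R) (f : dual V) d :
  assignment_eval f d = val d f.
Proof. by []. Qed.

Lemma assignment_eval_norm (V : completeNormedModType R) (f : dual V) :
  `|f| <= 1 -> `|assignment_eval f| <= 1.
Proof.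
move=> f1; apply: bop_norm_ball_le => // d d1.
rewrite assignment_evalE (le_trans (bop_normP (val d) f))//.
by rewrite -cs_normE mulr_ile1.
Qed.

Hypothesis ball_dense : weakstar_seq_dense
  [set canonical_operator X Y u | u in unit_ball (projective_tensor (dual X) (dual Y))]
  (unit_ball (dual Z)).

Lemma assignment_tens_bound (s : seq (DX * DY)) :
  `|\sum_(z <- s) assignment_tens z.1 z.2| <= 1 * inj_norm (tens_of s).
Proof.
rewrite mul1r cs_normE; apply: (assignment_norm_le ball_dense).
- exact: inj_norm_ge0.
- exact: assignment_valP.
- move=> f g f1 g1; rewrite assignment_tens_sum.
  apply: (le_trans (sum_fprod_bound s (assignment_eval f) (assignment_eval g))).
  by rewrite ler_piMr ?inj_norm_ge0// mulr_ile1// assignment_eval_norm.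
Qed.

Definition assignment_tensor_map : bop (injective_tensor DX DY) DZ :=
  inj_lift assignment_tens_linear assignment_tens_bound.

Local Notation Phi := assignment_tensor_map.

Lemma assignment_tensor_mapE x y : Phi (inj_tens x y) = assignment_tens x y.
Proof. exact: inj_liftE. Qed.

(** Arbitrary functionals [F] and [G] are replaced by evaluations one at a time. Contracting by [F]
    leaves an element of [DY], normed by points [g] of [dual Y]; contracting by such a [g] instead
    leaves an element of [DX], normed by points of [dual X]. *)
Lemma assignment_tensor_map_lower (s : seq (DX * DY)) (c : R) : 0 <= c ->
  (forall f g, `|f| <= 1 -> `|g| <= 1 -> `|\sum_(z <- s) val z.1 f * val z.2 g| <= c) ->
  inj_norm (tens_of s) <= c.
Proof.
move=> c0 sc; apply: inj_norm_le => F G F1 G1; rewrite tens_of_fprod.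
have -> : \sum_(z <- s) F z.1 * G z.2 = G (\sum_(z <- s) (F z.1 : R) *: z.2).
  by rewrite bop_sumr; apply: eq_bigr => z _; rewrite bopZr.
rewrite (le_trans (bop_norm_ball _ G1))// cs_normE.
apply: bop_norm_ball_le => // g g1.
have -> : val (\sum_(z <- s) (F z.1 : R) *: z.2) g =
    F (\sum_(z <- s) (val z.2 g : R) *: z.1).
  rewrite -assignment_evalE !bop_sumr; apply: eq_bigr => z _.
  by rewrite !bopZr [RHS]mulrC.
rewrite (le_trans (bop_norm_ball _ F1))// cs_normE.
apply: bop_norm_ball_le => // f f1.
rewrite -assignment_evalE bop_sumr.
rewrite (eq_bigr (fun z : DX * DY => val z.1 f * val z.2 g)); first exact: sc.
by move=> z _; rewrite bopZr [RHS]mulrC.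
Qed.

Lemma assignment_tensor_map_norm u : `|Phi u| = `|u|.
Proof.
apply/eqP; rewrite eq_le; apply/andP; split.
  have := inj_lift_norm assignment_tens_linear assignment_tens_bound u.
  by rewrite mul1r.
apply: (completion_norm_ge (T := Phi)) => t; have [s ->] := tensor_sum t.
rewrite -/(tens_of s) /assignment_tensor_map inj_lift_sum.
apply: assignment_tensor_map_lower => // f g f1 g1.
rewrite -assignment_tens_sum cs_normE (le_trans (bop_normP _ _))//.
by rewrite ler_piMr// (le_trans (norm_ftens f g))// mulr_ile1.
Qed.

Hypothesis ball_compact_X : weakstar_seq_compact (unit_ball (dual X)).
Hypothesis ball_compact_Y : weakstar_seq_compact (unit_ball (dual Y)).
Hypothesis assignment_ap : approximation_property DX \/ approximation_property DY.

(** For [s n] weak-star null and [g n] in the ball, [s n x * g n y] tends to 0 however [g n] varies,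
    so [ftens (s n) (g n)] is weak-star null. *)
Lemma left_operator_tot_bounded (z : DZ) :
  tot_bounded [set left_operator z f | f in unit_ball (dual X)].
Proof.
apply: (image_tot_bounded (cs_valP z) (left_operatorE z) (@norm_ftens R X Y)) => //.
move=> s g [C sC] s0 g1; apply: (@weakstar_cvg_tens _ _ _ _ C) => [n|x y e e0].
  by rewrite (le_trans (norm_ftens _ _))// -[C]mulr1 ler_pM.
have [N HN] := weakstar_cvg_mul x y s0 g1 e0.
by exists N => n /HN; rewrite ftensE.
Qed.

Lemma right_operator_tot_bounded (z : DZ) :
  tot_bounded [set right_operator z g | g in unit_ball (dual Y)].
Proof.
apply: (image_tot_bounded (h := fun g f => ftens f g) (cs_valP z) (right_operatorE z)) => //.
  by move=> g f; rewrite mulrC; exact: norm_ftens.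
move=> s f [C sC] s0 f1; apply: (@weakstar_cvg_tens _ _ _ _ C) => [n|x y e e0].
  by rewrite (le_trans (norm_ftens _ _))// mulrC -[C]mulr1 ler_pM.
have [N HN] := weakstar_cvg_mul y x s0 f1 e0.
by exists N => n /HN; rewrite ftensE mulrC.
Qed.

Lemma assignment_tensor_map_dense (z : DZ) e : 0 < e -> exists u, `|Phi u - z| <= e.
Proof.
move=> e0.
have [s sz] : exists s : seq (DX * DY), forall f g, `|f| <= 1 -> `|g| <= 1 ->
    `|val z (ftens f g) - \sum_(w <- s) val w.1 f * val w.2 g| <= e.
  (* [compact_tensor_approximation] wants the approximation property in the target of the operator.
     If [DX] has it, [right_operator z] is used and the pairs are flipped afterwards. *)
  case: assignment_ap => ap.
    have UV g f : val (right_operator z g) f = val (left_operator z f) g.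
      by rewrite right_operatorE left_operatorE.
    have [s sz] := compact_tensor_approximation UV (right_operator_tot_bounded z) ap e0.
    exists [seq (w.2, w.1) | w <- s] => f g f1 g1; have := sz g f g1 f1.
    rewrite right_operatorE big_map; congr (`|_ - _| <= _).
    by apply: eq_bigr => w _; rewrite mulrC.
  have UV f g : val (left_operator z f) g = val (right_operator z g) f.
    by rewrite right_operatorE left_operatorE.
  have [s sz] := compact_tensor_approximation UV (left_operator_tot_bounded z) ap e0.
  by exists s => f g f1 g1; have := sz f g f1 g1; rewrite left_operatorE.
exists (to_completion _ (tens_of s)).
rewrite /assignment_tensor_map inj_lift_sum cs_normE.
apply: (assignment_norm_le ball_dense); [exact: ltW|exact: assignment_valP|].
move=> f g f1 g1.
rewrite -assignment_evalE bopBr distrC !assignment_evalE assignment_tens_sum.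
exact: sz.
Qed.

Lemma assignment_tensor_iso :
  exists Psi : bop DZ (injective_tensor DX DY), cancel Phi Psi /\ cancel Psi Phi.
Proof.
exact: isometric_dense_iso assignment_tensor_map_norm assignment_tensor_map_dense.
Qed.

(** This matches the copy of X (x) Y inside Delta X (x) Delta Y with the subspace divided out on the
    other side. *)
Lemma assignment_tensor_map_canon w :
  Phi (tensor_map (canon I X) (canon I Y) w) = canon I Z w.
Proof.
rewrite -bcompE; congr (bop_fun _ w); apply: inj_bop_eq => x y.
rewrite bcompE tensor_mapE assignment_tensor_mapE.
apply: cs_val_eq; exact: bidual_tens_canonical.
Qed.

End assignment_tensor.

(** * Quotients, products and the splitting of the tensor product *)

Section identity.
Context {R : realType} (V : completeNormedModType R).

Lemma bid_linear : linear (@idfun V). Proof. by []. Qed.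

Lemma bid_bounded (v : V) : `|idfun v| <= 1 * `|v|. Proof. by rewrite mul1r. Qed.

Definition bid : bop V V := mkbop bid_linear bid_bounded.

Lemma bidE v : bid v = v. Proof. by []. Qed.

End identity.

Section quotient_maps.
Context {R : realType} (V W : completeNormedModType R) (S : Defs.subspace V).

Lemma qproj_linear : linear (@qproj R V S).
Proof. by move=> a x y; rewrite /qproj linearP. Qed.

Lemma qproj_bounded v : `|qproj S v| <= 1 * `|v|.
Proof.
by rewrite mul1r norm_hpi /= (le_trans (dist_le v (subspace0 S)))// subr0.
Qed.

Definition qmap : bop V (quotient S) := mkbop qproj_linear qproj_bounded.

Lemma qmapE v : qmap v = qproj S v. Proof. by []. Qed.

Lemma qmap_sub v : ss_set S v -> qmap v = 0.
Proof. by move=> Sv; apply/normr0_eq0; rewrite norm_hpi /= dist_eq0. Qed.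

Lemma qmap_surj (c : quotient S) : exists v, c = qmap v.
Proof. by exists (repr c); rewrite qmapE /qproj hpiK. Qed.

(** Since [T] vanishes on [S], [|T v|] is at most [|T|] times the distance from [v] to [S], which is
    the quotient norm. *)
Lemma quotient_lift (T : bop V W) : (forall v, ss_set S v -> T v = 0) ->
  exists T' : bop (quotient S) W, forall v, T' (qmap v) = T v.
Proof.
move=> TS; have Td v : `|T v| <= `|T| * dist S v.
  apply/ler_addgt0Pr => e e0; have T0 : 0 < `|T| + 1 by rewrite ltr_wpDl.
  have [w Sw vw] := dist_adherent S v (divr_gt0 e0 T0).
  have -> : T v = T (v - w) by rewrite bopBr (TS w)// subr0.
  rewrite (le_trans (bop_normP T _))// (le_trans (ler_wpM2l _ (ltW vw)))//.
  rewrite mulrDr lerD2l mulrCA ler_piMr ?(ltW e0)//.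
  by rewrite ler_pdivrMr// mul1r lerDl.
pose t (q : quotient S) : W := T (repr q).
have tE v : t (qmap v) = T v.
  apply/eqP; rewrite -subr_eq0 -bopBr -normr_le0 (le_trans (Td _))//.
  by rewrite [dist S _](repr_hpi (Cseminorm (@dist_complete R V S)) v) mulr0.
have tl : linear t.
  move=> a c c'; have [x ->] := qmap_surj c; have [y ->] := qmap_surj c'.
  by rewrite -bopZr -bopDr !tE bopDr bopZr.
have tb q : `|t q| <= `|T| * `|q|.
  by have [v ->] := qmap_surj q; rewrite tE (le_trans (Td v))// [`|qmap v|]norm_hpi.
by exists (mkbop tl tb).
Qed.

End quotient_maps.

Section bounded_operators_to_products.
Context {R : realType}.
Implicit Types U V W : completeNormedModType R.

Lemma pair_linear U V W (A : bop U V) (B : bop U W) :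
  linear (fun u => (A u, B u) : (V * W)%type).
Proof. by move=> a u v; rewrite !bopDr !bopZr. Qed.

Lemma pair_bounded U V W (A : bop U V) (B : bop U W) u :
  `|(A u, B u) : (V * W)%type| <= (`|A| + `|B|) * `|u|.
Proof.
rewrite prod_normE ge_max /= mulrDl.
rewrite (le_trans (bop_normP A u)) ?lerDl ?mulr_ge0//=.
by rewrite (le_trans (bop_normP B u))// lerDr mulr_ge0.
Qed.

Definition bpair U V W (A : bop U V) (B : bop U W) : bop U (V * W)%type :=
  mkbop (pair_linear A B) (pair_bounded A B).

Lemma copair_linear U V W (A : bop V U) (B : bop W U) :
  linear (fun p : (V * W)%type => A p.1 + B p.2).
Proof.
by move=> a [u u'] [v v'] /=; rewrite !bopDr !bopZr scalerDr addrACA.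
Qed.

Lemma copair_bounded U V W (A : bop V U) (B : bop W U) (p : (V * W)%type) :
  `|A p.1 + B p.2| <= (`|A| + `|B|) * `|p|.
Proof.
rewrite prod_normE mulrDl (le_trans (ler_normD _ _))// lerD//.
  by rewrite (le_trans (bop_normP A _))// ler_wpM2l// le_max lexx.
by rewrite (le_trans (bop_normP B _))// ler_wpM2l// le_max lexx orbT.
Qed.

Definition bcopair U V W (A : bop V U) (B : bop W U) : bop (V * W)%type U :=
  mkbop (copair_linear A B) (copair_bounded A B).

Lemma prod3_iso (D : completeNormedModType R) U V W (a : bop D U) (b : bop D V) (c : bop D W)
    (a' : bop U D) (b' : bop V D) (c' : bop W D) :
  cancel a' a -> cancel b' b -> cancel c' c ->
  (forall y, a (b' y) = 0) -> (forall z, a (c' z) = 0) ->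
  (forall x, b (a' x) = 0) -> (forall z, b (c' z) = 0) ->
  (forall x, c (a' x) = 0) -> (forall y, c (b' y) = 0) ->
  (forall d, a' (a d) + b' (b d) + c' (c d) = d) ->
  linearly_isomorphic D (U * V * W)%type.
Proof.
move=> aa bb cc ab ac ba bc ca cb abc.
exists (bpair (bpair a b) c), (bcopair (bcopair a' b') c'); split; first exact: abc.
move=> [[x y] z].
have E : bcopair (bcopair a' b') c' (x, y, z) = a' x + b' y + c' z by [].
rewrite E; congr ((_, _), _); rewrite !bopDr.
- by rewrite aa ab ac !addr0.
- by rewrite ba bb bc add0r addr0.
- by rewrite ca cb cc !add0r.
Qed.

End bounded_operators_to_products.

Section splittings.
Context {R : realType}.
Implicit Types V K Q : completeNormedModType R.

(* [V] is the direct sum of [K] and [Q], with injections [k], [s] and projections [p], [q]. *)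
Record splitting V K Q (k : bop K V) (q : bop V Q) (p : bop V K) (s : bop Q V) := Splitting {
  split_pk : forall x, p (k x) = x;
  split_qs : forall c, q (s c) = c;
  split_qk : forall x, q (k x) = 0;
  split_ps : forall c, p (s c) = 0;
  split_kpsq : forall v, k (p v) + s (q v) = v }.

(** The projection [P] takes values in the image of the isometry [canon], whose inverse turns it
    into [p]; the section [s] is induced by the complementary projection, which vanishes on that
    image. *)
Lemma complemented_splitting (I : testing_ideal R) (X : completeNormedModType R) :
  complemented (canonical_image I X) ->
  exists p s, splitting (canon I X) (qmap (canonical_subspace I X)) p s.
Proof.
move=> [P [PP Pim]]; set k := canon I X; set q := qmap _.
have kinj x x' : k x = k x' -> x = x'.
  move=> xx'; apply/eqP; rewrite -subr_eq0 -normr_eq0 -(norm_canon I) bopBr.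
  by rewrite -/k xx' subrr normr0.
have /choice[p pP] : forall d, exists x, P d = k x.
  by move=> d; apply/canonical_imageP; rewrite -Pim; exists d.
have Pk x : P (k x) = k x.
  have [d _ <-] : range P (k x) by rewrite Pim; apply/canonical_imageP; exists x.
  exact: PP.
have pl : linear p by move=> a u v; apply: kinj; rewrite bopDr bopZr -!pP bopDr bopZr.
have pb v : `|p v| <= `|P| * `|v| by rewrite -(norm_canon I) -/k -pP bop_normP.
pose p' : bop (assignment I X) X := mkbop pl pb.
have p'P d : k (p' d) = P d by rewrite pP.
have pk x : p' (k x) = x by apply: kinj; rewrite p'P Pk.
have [d|s sP] := quotient_lift (S := canonical_subspace I X) (T := bid _ - P).
  by move=> /canonical_imageP[x ->]; rewrite bopB -/k Pk subrr.
have sq v : s (q v) = v - k (p' v) by rewrite sP bopB p'P.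
have qk x : q (k x) = 0 by apply: qmap_sub; apply/canonical_imageP; exists x.
exists p', s; split=> //.
- by move=> c; have [v ->] := qmap_surj c; rewrite sq bopBr qk subr0.
- by move=> c; have [v ->] := qmap_surj c; rewrite sq bopBr pk subrr.
- by move=> v; rewrite sq addrC subrK.
Qed.

Variables (V K Q V' K' Q' : completeNormedModType R).
Variables (k : bop K V) (q : bop V Q) (p : bop V K) (s : bop Q V).
Variables (k' : bop K' V') (q' : bop V' Q') (p' : bop V' K') (s' : bop Q' V').
Hypotheses (sp : splitting k q p s) (sp' : splitting k' q' p' s').

Lemma inj_tens0l (X Y : completeNormedModType R) (y : Y) : inj_tens (0 : X) y = 0.
Proof.
apply/eqP; rewrite -normr_le0 (le_trans (norm_inj_tens _ _))//.
by rewrite normr0 mul0r.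
Qed.

Lemma inj_tens0r (X Y : completeNormedModType R) (x : X) : inj_tens x (0 : Y) = 0.
Proof.
apply/eqP; rewrite -normr_le0 (le_trans (norm_inj_tens _ _))//.
by rewrite normr0 mulr0.
Qed.

Lemma tensor_map_comp (X Y X1 Y1 X2 Y2 : completeNormedModType R)
    (A : bop X X1) (B : bop Y Y1) (A' : bop X1 X2) (B' : bop Y1 Y2) u :
  tensor_map A' B' (tensor_map A B u) = tensor_map (bcomp A' A) (bcomp B' B) u.
Proof.
rewrite -[LHS]bcompE; congr (bop_fun _ u); apply: inj_bop_eq => x y.
by rewrite bcompE !tensor_mapE.
Qed.

Lemma tensor_map_id (X Y : completeNormedModType R) (A : bop X X) (B : bop Y Y) u :
  (forall x, A x = x) -> (forall y, B y = y) -> tensor_map A B u = u.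
Proof.
move=> A1 B1; rewrite -[RHS]bidE; congr (bop_fun _ u); apply: inj_bop_eq => x y.
by rewrite tensor_mapE A1 B1.
Qed.

Lemma tensor_map_0 (X Y X' Y' : completeNormedModType R) (A : bop X X') (B : bop Y Y') u :
  (forall x, A x = 0) \/ (forall y, B y = 0) -> tensor_map A B u = 0.
Proof.
move=> AB; rewrite -[RHS]/((0 : bop _ _) u); congr (bop_fun _ u).
apply: inj_bop_eq => x y; rewrite tensor_mapE.
by case: AB => ->; rewrite ?inj_tens0l ?inj_tens0r.
Qed.

(** Both factors are split and the product expanded into four terms; the one isolated on the right
    is the one that the final quotient annihilates. *)
Lemma inj_tens_split x y :
  inj_tens (k (p x)) (s' (q' y)) + inj_tens (s (q x)) (k' (p' y)) +
  inj_tens (s (q x)) (s' (q' y)) = inj_tens x y - inj_tens (k (p x)) (k' (p' y)).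
Proof.
have Dl (u u' : V) (v : V') : inj_tens (u + u') v = inj_tens u v + inj_tens u' v.
  by rewrite -[u in LHS]scale1r inj_tensDl scale1r.
have Dr (u : V) (v v' : V') : inj_tens u (v + v') = inj_tens u v + inj_tens u v'.
  by rewrite -[v in LHS]scale1r inj_tensDr scale1r.
have -> : inj_tens x y = inj_tens (k (p x) + s (q x)) (k' (p' y) + s' (q' y)).
  by rewrite (split_kpsq sp) (split_kpsq sp').
rewrite Dl !Dr; move: (inj_tens _ _) (inj_tens _ _) (inj_tens _ _) (inj_tens _ _).
by move=> a b c d; rewrite [RHS]addrAC [X in X + (_ + _)]addrAC subrr add0r addrA.
Qed.

Lemma tensor_map_split u :
  tensor_map k s' (tensor_map p q' u) + tensor_map s k' (tensor_map q p' u) +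
  tensor_map s s' (tensor_map q q' u) = u - tensor_map k k' (tensor_map p p' u).
Proof.
rewrite !tensor_map_comp -!bopD -{2}(bidE u) -bopB.
congr (bop_fun _ u); apply: inj_bop_eq => x y.
by rewrite bopB !bopD bidE !tensor_mapE !bcompE inj_tens_split.
Qed.

(** The maps p (x) q', q (x) p' and q (x) q' vanish on the image of k (x) k' because [q] kills [k]
    and [q'] kills [k'], hence descend to the quotient. Their right inverses come from k (x) s', s
    (x) k' and s (x) s'. *)
Lemma quotient_tensor_iso (D : completeNormedModType R) (S : Defs.subspace D)
    (Phi : bop (injective_tensor V V') D) (Psi : bop D (injective_tensor V V')) :
  cancel Phi Psi -> cancel Psi Phi ->
  (forall d, ss_set S d <-> exists w, d = Phi (tensor_map k k' w)) ->
  linearly_isomorphic (Defs.quotient S)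
    (injective_tensor K Q' * injective_tensor Q K' * injective_tensor Q Q')%type.
Proof.
move=> PhiK PsiK Sk.
have lift (W : completeNormedModType R) (T : bop (injective_tensor V V') W) :
    (forall w, T (tensor_map k k' w) = 0) ->
    exists T' : bop (Defs.quotient S) W, forall u, T' (qmap S (Phi u)) = T u.
  move=> Tk; have [d /Sk[w ->]|T' T'E] := quotient_lift (S := S) (T := bcomp T Psi).
    by rewrite bcompE PhiK.
  by exists T' => u; rewrite T'E bcompE PhiK.
have [w|A AE] := lift _ (tensor_map p q').
  by rewrite tensor_map_comp tensor_map_0//; right; exact: (split_qk sp').
have [w|B BE] := lift _ (tensor_map q p').
  by rewrite tensor_map_comp tensor_map_0//; left; exact: (split_qk sp).
have [w|C CE] := lift _ (tensor_map q q').
  by rewrite tensor_map_comp tensor_map_0//; left; exact: (split_qk sp).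
pose F := bcomp (qmap S) Phi.
have FE u : F u = qmap S (Phi u) by [].
apply: (@prod3_iso R _ _ _ _ A B C (bcomp F (tensor_map k s'))
  (bcomp F (tensor_map s k')) (bcomp F (tensor_map s s'))).
- move=> a; rewrite bcompE FE AE tensor_map_comp.
  by apply: tensor_map_id; [exact: (split_pk sp)|exact: (split_qs sp')].
- move=> b; rewrite bcompE FE BE tensor_map_comp.
  by apply: tensor_map_id; [exact: (split_qs sp)|exact: (split_pk sp')].
- move=> c; rewrite bcompE FE CE tensor_map_comp.
  by apply: tensor_map_id; [exact: (split_qs sp)|exact: (split_qs sp')].
- move=> b; rewrite bcompE FE AE tensor_map_comp.
  by apply: tensor_map_0; left; exact: (split_ps sp).
- move=> c; rewrite bcompE FE AE tensor_map_comp.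
  by apply: tensor_map_0; left; exact: (split_ps sp).
- move=> a; rewrite bcompE FE BE tensor_map_comp.
  by apply: tensor_map_0; left; exact: (split_qk sp).
- move=> c; rewrite bcompE FE BE tensor_map_comp.
  by apply: tensor_map_0; right; exact: (split_ps sp').
- move=> a; rewrite bcompE FE CE tensor_map_comp.
  by apply: tensor_map_0; left; exact: (split_qk sp).
- move=> b; rewrite bcompE FE CE tensor_map_comp.
  by apply: tensor_map_0; right; exact: (split_qk sp').
(* By [tensor_map_split] the three components recombine to [Psi d] up to an element of the image of
   [tensor_map k k'], which [Phi] sends into [S]. *)
- move=> e; have [d ->] := qmap_surj e; rewrite -(PsiK d) AE BE CE !bcompE -!bopDr.
  rewrite tensor_map_split !bopBr [X in _ - X]qmap_sub ?subr0//.
  by apply/Sk; exists (tensor_map p p' (Psi d)).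
Qed.

End splittings.

Theorem theorem4p10 (R : realType) (I : testing_ideal R)
  (X Y : completeNormedModType R)
  (bidual_ap_X : approximation_property (bidual X))
  (bidual_ap_Y : approximation_property (bidual Y))
  (ball_dense : weakstar_seq_dense
     [set canonical_operator X Y u | u in unit_ball (projective_tensor (dual X) (dual Y))]
     (unit_ball (dual (injective_tensor X Y))))
  (ball_compact_X : weakstar_seq_compact (unit_ball (dual X)))
  (ball_compact_Y : weakstar_seq_compact (unit_ball (dual Y)))
  (assignment_ap : approximation_property (assignment I X) \/
                   approximation_property (assignment I Y))
  (complemented_X : complemented (canonical_image I X))
  (complemented_Y : complemented (canonical_image I Y)) :
  linearly_isomorphic
    (assignment_quotient I (injective_tensor X Y))
    (injective_tensor X (assignment_quotient I Y) *
     injective_tensor (assignment_quotient I X) Y *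
     injective_tensor (assignment_quotient I X) (assignment_quotient I Y))%type.
Proof.
have [Psi [PhiK PsiK]] :=
  assignment_tensor_iso ball_dense ball_compact_X ball_compact_Y assignment_ap.
have [p [s sp]] := complemented_splitting complemented_X.
have [p' [s' sp']] := complemented_splitting complemented_Y.
apply: (quotient_tensor_iso sp sp' PhiK PsiK) => d.
rewrite -[ss_set _ d]/(canonical_image I _ d) canonical_imageP.
by split=> -[w ->]; exists w; rewrite assignment_tensor_map_canon.
Qed.
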